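(* Let $L$ be a number field of degree $d=[L:\mathbb{Q}]$, let $\mathcal{O}_L$ be its ring of integers, and let $t_L$ be the positive integer with $T_{L/\mathbb{Q}}(\mathcal{O}_L)=t_L\mathbb{Z}$. Then the following are equivalent: (i) $t_L\geq 2$; (ii) there is a prime factor $p$ of $d$ such that, if $\wp_1^{e_1}\cdots\wp_s^{e_s}$ is the prime factorization of the ideal $p\mathcal{O}_L$ in $\mathcal{O}_L$ (with distinct prime ideals $\wp_i$), then $p$ divides all of $e_1,\dots,e_s$; (iii) there is a prime number $p$ such that, if $\wp_1^{e_1}\cdots\wp_s^{e_s}$ is the prime factorization of $p\mathcal{O}_L$ in $\mathcal{O}_L$, then $p$ divides all of $e_1,\dots,e_s$.
   Context: $T_{L/\mathbb{Q}}:L\to\mathbb{Q}$ is the trace map $T_{L/\mathbb{Q}}(\alpha)=\sum_{i=1}^d\sigma_i(\alpha)$ over the $d$ embeddings $\sigma_i:L\to\mathbb{C}$. Its restriction to $\mathcal{O}_L$ has image a nonzero ideal of $\mathbb{Z}$, written $t_L\mathbb{Z}$ with $t_L\in\mathbb{N}$, $t_L\ge1$. *)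

(* Defs.v *)
From HB Require Import structures.
From mathcomp Require Import all_boot all_order all_algebra all_field.
Set Implicit Arguments. Unset Strict Implicit. Unset Printing Implicit Defensive.
Import GRing.Theory Num.Theory.
Local Open Scope ring_scope.

Section NumberFieldIdeals.
Variable L : fieldExtType rat.

Definition in_OL (x : L) : Prop :=
  exists q : {poly int}, q \is monic /\ root (map_poly (intr : int -> L) q) x.

Definition is_ideal (I : L -> Prop) : Prop :=
  [/\ forall x, I x -> in_OL x,
      I 0,
      forall x y, I x -> I y -> I (x + y)
    & forall a x, in_OL a -> I x -> I (a * x)].

Definition ideal_eq (I J : L -> Prop) : Prop := forall x, I x <-> J x.

Definition ideal_mul (I J : L -> Prop) : L -> Prop :=
  fun x => exists n (a b : 'I_n -> L),
    (forall i, I (a i) /\ J (b i)) /\ x = \sum_(i < n) a i * b i.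

Definition ideal_pow (I : L -> Prop) (n : nat) : L -> Prop :=
  iter n (ideal_mul I) in_OL.

Definition prime_ideal (P : L -> Prop) : Prop :=
  [/\ is_ideal P,
      exists x, P x /\ x != 0,
      ~ P 1
    & forall a b, in_OL a -> in_OL b -> P (a * b) -> P a \/ P b].

Definition principal_nat (p : nat) : L -> Prop :=
  fun x => exists y, in_OL y /\ x = p%:R * y.

Definition is_factorization (p s : nat) (P : 'I_s -> (L -> Prop))
    (e : 'I_s -> nat) : Prop :=
  [/\ forall i, prime_ideal (P i),
      forall i j, i != j -> ~ ideal_eq (P i) (P j),
      forall i, (0 < e i)%N
    & ideal_eq (principal_nat p)
        (foldr ideal_mul in_OL [seq ideal_pow (P i) (e i) | i <- enum 'I_s])].

Definition divides_all_exponents (p : nat) : Prop :=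
  forall s (P : 'I_s -> (L -> Prop)) (e : 'I_s -> nat),
    is_factorization p P e -> forall i, (p %| e i)%N.

End NumberFieldIdeals.

(* Main.v *)
Require Import Defs.
From HB Require Import structures.
From mathcomp Require Import all_boot all_order all_algebra all_field.
From mathcomp Require Import boolp ring.

(* For a prime p, p divides t_L iff p divides every exponent in a factorization
   p O_L = P_1^e_1 ... P_s^e_s; the theorem follows because t_L divides T(1) = d.
   In an integral basis of O_L, T(x) is the trace of the matrix of multiplication
   by x, so T(x) mod p is the trace of x on the F_p-space O_L / p O_L.  Refining
   O_L > P_1 > P_1^2 > ... > p O_L, each quotient I / I P_i is isomorphic to the
   residue field O_L / P_i, whence T(x) = sum_i e_i Tr(x | O_L / P_i) mod p.  If p
   divides all e_i this vanishes.  Conversely, the trace of the residue field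
   O_L / P_i is nonzero, and by Chinese remaindering some x has nonzero trace there
   and lies in all the other P_j, so e_i = 0 mod p.  The existence of a factorization
   of p O_L, which makes the condition on the exponents nonvacuous, rests on the
   finiteness of O_L / p O_L. *)

Set Implicit Arguments. Unset Strict Implicit. Unset Printing Implicit Defensive.
Import Order.TTheory GRing.Theory Num.Theory.
Local Open Scope ring_scope.

(** * Algebraic integers and ideals *)

(** The factorization theory is confined to ideals that contain a fixed prime p. Since O_L / p O_L
    is finite, powers of an element repeat modulo p, which yields inverses modulo primes, and strict
    chains of such ideals are bounded, which yields induction on ideals. Inverse ideals are scaled
    so as to stay inside O_L: a cofactor C with I C = p O_L stands for p I^-1. Likewise the spaces I
    / J are never formed: bases are families in I, coordinates are integer vectors, and only matrix
    identities are reduced modulo p. Hence [zmx] leaves its target ring open: one integer matrix is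
    read in [L], [rat], [algC] or ['F_p]. *)

Notation zmx M := (map_mx intr M).

Section IntegerRing.
Variable L : fieldExtType rat.
Implicit Types x y z : L.

Lemma in_OL_integral x : in_OL x <-> integralOver (intr : int -> L) x.
Proof. by split=> [[q [mq rq]]|[q mq rq]]; exists q. Qed.

Lemma in_OLB x y : in_OL x -> in_OL y -> in_OL (x - y).
Proof. by rewrite !in_OL_integral; apply: integral_sub. Qed.

Lemma in_OLD x y : in_OL x -> in_OL y -> in_OL (x + y).
Proof. by rewrite !in_OL_integral; apply: integral_add. Qed.

Lemma in_OLM x y : in_OL x -> in_OL y -> in_OL (x * y).
Proof. by rewrite !in_OL_integral; apply: integral_mul. Qed.

Lemma in_OL_int (n : int) : in_OL (n%:~R : L).
Proof. by rewrite in_OL_integral; apply: integral_id. Qed.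

Lemma in_OL_nat n : in_OL (n%:R : L).
Proof. exact: (in_OL_int n). Qed.

Lemma in_OL0 : in_OL (0 : L). Proof. exact: (in_OL_int 0). Qed.
Lemma in_OL1 : in_OL (1 : L). Proof. exact: (in_OL_int 1). Qed.

Lemma in_OLX x n : in_OL x -> in_OL (x ^+ n).
Proof.
move=> Ox; elim: n => [|n IHn]; first exact: in_OL1.
by rewrite exprS; apply: in_OLM.
Qed.

Lemma is_ideal_OL : is_ideal (@in_OL L).
Proof. by split; [| exact: in_OL0 | exact: in_OLD | exact: in_OLM]. Qed.

Lemma idealM (I : L -> Prop) a x : is_ideal I -> in_OL a -> I x -> I (a * x).
Proof. by case=> _ _ _ h; apply: h. Qed.

Lemma idealD (I : L -> Prop) x y : is_ideal I -> I x -> I y -> I (x + y).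
Proof. by case=> _ _ h _; apply: h. Qed.

Lemma ideal0 (I : L -> Prop) : is_ideal I -> I 0.
Proof. by case. Qed.

Lemma ideal_sub (I : L -> Prop) x : is_ideal I -> I x -> in_OL x.
Proof. by case=> h _ _ _; apply: h. Qed.

Lemma idealN (I : L -> Prop) x : is_ideal I -> I x -> I (- x).
Proof.
by move=> iI Ix; rewrite -mulN1r; apply: idealM => //; apply: (in_OL_int (-1)).
Qed.

Lemma idealB (I : L -> Prop) x y : is_ideal I -> I x -> I y -> I (x - y).
Proof. by move=> iI Ix Iy; apply: idealD => //; apply: idealN. Qed.

Lemma idealMr (I : L -> Prop) a x : is_ideal I -> in_OL a -> I x -> I (x * a).
Proof. by move=> iI Oa Ix; rewrite mulrC; apply: idealM. Qed.

Lemma ideal_sum (I : L -> Prop) (T : Type) (r : seq T) (P : pred T) F :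
  is_ideal I -> (forall i, P i -> I (F i)) -> I (\sum_(i <- r | P i) F i).
Proof.
by move=> iI IF; apply: big_ind => // [|x y]; [exact: ideal0|exact: idealD].
Qed.

Lemma ideal_mulmx (I : L -> Prop) m n (N : 'M[int]_(m, n)) (b : 'cV[L]_n) :
  is_ideal I -> (forall i, I (b i 0)) -> forall i, I ((zmx N *m b) i 0).
Proof.
move=> iI Ib i; rewrite mxE; apply: ideal_sum => // j _.
by apply: idealM => //; rewrite mxE; apply: in_OL_int.
Qed.

(** z is an eigenvalue of N, hence a root of its monic characteristic polynomial. The transposes
    appear because [eigenvalueP] uses row vectors. *)
Lemma integral_eigen n (N : 'M[int]_n) (b : 'cV[L]_n) z :
  b != 0 -> z *: b = zmx N *m b -> in_OL z.
Proof.
move=> b0 zb; exists (char_poly N^T); split; first exact: char_poly_monic.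
rewrite map_char_poly -eigenvalue_root_char; apply/eigenvalueP; exists b^T.
  by rewrite -map_trmx -trmx_mul -zb linearZ.
by rewrite -trmx0 (inj_eq trmx_inj).
Qed.

Lemma common_denominator (I : finType) (q : I -> rat) :
  exists2 D : nat, (0 < D)%N & exists n : I -> int, forall i, D%:R * q i = (n i)%:~R.
Proof.
exists `|(\prod_i denq (q i))%R|%N.
  by rewrite absz_gt0; apply/prodf_neq0 => i _; apply: denq_neq0.
exists (fun i => (\prod_(j | j != i) denq (q j)) * numq (q i)) => i.
rewrite pmulrn gez0_abs; last by apply: prodr_ge0 => j _; apply: denq_ge0.
rewrite (bigD1 i) //= !intrM mulrAC -{2}[q i]divq_num_den mulrC; congr (_ * _).
by rewrite mulrC divfK // intr_eq0 denq_neq0.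
Qed.

(** Multiplication by x has a rational matrix in a Q-basis; a common denominator D turns it into an
    integer matrix with eigenvalue D x. *)
Lemma in_OL_denominator x : exists2 D : nat, (0 < D)%N & in_OL (D%:R * x).
Proof.
pose e := vbasis {:L}.
pose A := fun ij : 'I_(\dim {:L}) * 'I_(\dim {:L}) => coord e ij.2 (x * e`_ij.1).
have [D D_gt0 [n Dn]] := common_denominator A; exists D => //.
apply: (@integral_eigen _ (\matrix_(i, j) n (i, j)) (\col_i e`_i)).
  have d_gt0 : (0 < \dim {:L})%N by rewrite adim_gt0.
  apply/negP => /eqP/matrixP/(_ (Ordinal d_gt0) 0); rewrite !mxE => e0.
  have e0' : e`_(Ordinal d_gt0) \in e by rewrite mem_nth ?size_tuple.
  by have := free_not0 (basis_free (vbasisP _)) e0'; rewrite e0 eqxx.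
apply/matrixP => i j; rewrite !mxE.
rewrite -mulrA {1}(coord_basis (vbasisP _) (memvf (x * e`_i))) mulr_sumr.
apply: eq_bigr => k _; rewrite !mxE -/e.
have -> : (n (i, k))%:~R = (D%:R * A (i, k))%:A :> L.
  by rewrite Dn alg_num_field ratr_int.
by rewrite mulr_algl -scalerA scaler_nat mulr_natl.
Qed.

End IntegerRing.

(** * Integral bases and the trace form *)

(** The cofactors along row [i0] do not see that row, so they are those of the identity matrix. This
    is the factor by which the basis exchange in [lattice_basis] scales [\det (embed b)]. *)
Lemma det_row_unit (R : comNzRingType) n (i0 : 'I_n) (q : 'I_n -> R) :
  \det (\matrix_(i, j) (if i == i0 then q j else (i == j)%:R)) = q i0.
Proof.
set M := \matrix_(i, j) _; rewrite (expand_det_row _ i0).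
have cofM j : cofactor M i0 j = (j == i0)%:R.
  have := mul_mx_adj (1%:M : 'M[R]_n); rewrite mul1mx det1 => /matrixP/(_ j i0).
  rewrite !mxE => <-; rewrite /cofactor; congr (_ * \det _).
  by apply/matrixP => i k; rewrite !mxE eq_sym (negPf (neq_lift _ _)).
rewrite (bigD1 i0) //= big1 ?addr0 => [|j /negPf j0].
  by rewrite cofM eqxx mulr1 mxE eqxx.
by rewrite cofM j0 mulr0.
Qed.

(** V conjugates N to a diagonal matrix over the fraction field; the adjugate keeps the computation
    in R. It serves for the complex embeddings and, in residue fields, for the powers of
    Frobenius. *)
Lemma trace_of_conjugate (R : idomainType) n (V N : 'M[R]_n) (D : 'rV[R]_n) :
  \det V != 0 -> diag_mx D *m V = V *m N -> \tr N = \sum_i D 0 i.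
Proof.
move=> V0 DV; apply: (mulfI V0).
have -> : \det V * \tr N = \tr (\adj V *m (V *m N)).
  by rewrite mulmxA mul_adj_mx mul_scalar_mx mxtraceZ.
rewrite -DV mulmxA mxtrace_mulC mulmxA mul_mx_adj mul_scalar_mx mxtraceZ.
by rewrite mxtrace_diag.
Qed.

Section Lattices.
Variables (L : fieldExtType rat).
Variable sigma : 'I_(\dim {:L}) -> {rmorphism L -> algC}.
Local Notation d := (\dim {:L}).
Local Notation qmx M := (map_mx (in_alg L) M).
Definition Tr x := \sum_i sigma i x.
(** In the theorem this follows from the definition of [tL]. *)
Hypothesis Tr_int : forall x, in_OL x -> exists k : int, Tr x = k%:~R.
Implicit Types (x y : L) (b : 'cV[L]_d).

(** The square of its determinant is the discriminant of b. *)
Definition embed b := \matrix_(i, j) sigma i (b j 0).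

Lemma sigma_alg i (q : rat) : sigma i q%:A = ratr q.
Proof. by rewrite alg_num_field fmorph_rat. Qed.

Lemma TrZ (q : rat) x : Tr (q *: x) = ratr q * Tr x.
Proof.
rewrite mulr_sumr; apply: eq_bigr => i _.
by rewrite -mulr_algl rmorphM sigma_alg.
Qed.

Lemma Tr_sum n (F : 'I_n -> L) : Tr (\sum_i F i) = \sum_i Tr (F i).
Proof.
rewrite exchange_big; apply: eq_bigr => i _; exact: rmorph_sum.
Qed.

Lemma Tr1 : Tr 1 = d%:R.
Proof.
rewrite -[in RHS](card_ord d) -sumr_const.
by apply: eq_bigr => i _; rewrite rmorph1.
Qed.

Lemma embedM (M : 'M[rat]_d) b :
  embed (qmx M *m b) = embed b *m (map_mx ratr M)^T.
Proof.
apply/matrixP => i j; rewrite !mxE rmorph_sum; apply: eq_bigr => k _.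
by rewrite !mxE rmorphM sigma_alg mulrC.
Qed.

Lemma embed_gram b :
  (embed b)^T *m embed b = \matrix_(j, k) Tr (b j 0 * b k 0).
Proof.
by apply/matrixP => j k; rewrite !mxE; apply: eq_bigr => i _; rewrite !mxE rmorphM.
Qed.

Lemma zmx_qmx m n (M : 'M[int]_(m, n)) : zmx M = qmx (zmx M) :> 'M[L]_(m, n).
Proof. by apply/matrixP => i j; rewrite !mxE rmorph_int. Qed.

Lemma disc_int b : (forall i, in_OL (b i 0)) ->
  exists z : int, \det (embed b) ^+ 2 = z%:~R.
Proof.
move=> Ob; have Tb (jk : 'I_d * 'I_d) :
    exists k : int, Tr (b jk.1 0 * b jk.2 0) = k%:~R.
  by apply: Tr_int; apply: in_OLM.
have [g gE] := choice Tb; exists (\det (\matrix_(j, k) g (j, k))).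
rewrite -[X in X ^+ _]/(\det (embed b)) expr2 -{1}det_tr -det_mulmx embed_gram.
rewrite -det_map_mx; congr (\det _); apply/matrixP => j k.
by rewrite !mxE (gE (j, k)).
Qed.

Lemma span_of_free b : free [tuple b i 0 | i < d] ->
  forall x, exists c : 'rV[rat]_d, x = (qmx c *m b) 0 0.
Proof.
move=> fb x; have bb : basis_of {:L} [tuple b i 0 | i < d].
  by rewrite basisEfree fb subvf size_tuple leqnn.
exists (\row_i coord [tuple b i 0 | i < d] i x).
rewrite {1}(coord_basis bb (memvf x)) !mxE; apply: eq_bigr => i _.
by rewrite !mxE mulr_algl (nth_mktuple (fun i => b i 0)).
Qed.

(** Each embedding fixes the rationals, so a rational relation among the b_j is also one among the
    columns of [embed b]. *)
Lemma free_of_disc b : \det (embed b) != 0 -> free [tuple b i 0 | i < d].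
Proof.
move=> b0; apply/freeP => k kb; pose K := \col_i (ratr (k i) : algC).
suff K0 : K = 0.
  move=> i; move/matrixP/(_ i 0): K0; rewrite !mxE => /eqP.
  by rewrite fmorph_eq0 => /eqP.
apply/eqP; apply: contraNT b0 => K0; rewrite -det_tr; apply/det0P; exists K^T.
  by rewrite -trmx0 (inj_eq trmx_inj).
rewrite -trmx_mul; apply/eqP; rewrite -trmx0 (inj_eq trmx_inj); apply/eqP.
apply/matrixP => i j; rewrite [RHS]mxE -[RHS](rmorph0 (sigma i)) -kb mxE rmorph_sum.
apply: eq_bigr => l _; rewrite !mxE (nth_mktuple (fun i => b i 0)).
by rewrite -mulr_algl rmorphM sigma_alg mulrC.
Qed.

(* The trace form is nondegenerate because T(x x^-1) = T(1) = d. *)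
Lemma disc_neq0 b : (forall i, in_OL (b i 0)) -> free [tuple b i 0 | i < d] ->
  \det (embed b) != 0.
Proof.
move=> Ob fb; suff : \det (\matrix_(j, k) Tr (b j 0 * b k 0)) != 0.
  by rewrite -embed_gram det_mulmx mulf_eq0 negb_or => /andP[].
have Tb (jk : 'I_d * 'I_d) : exists k : int, Tr (b jk.1 0 * b jk.2 0) = k%:~R.
  by apply: Tr_int; apply: in_OLM.
have [g gE] := choice Tb; pose G : 'M[rat]_d := \matrix_(j, k) (g (j, k))%:~R.
have -> : \matrix_(j, k) Tr (b j 0 * b k 0) = map_mx ratr G.
  by apply/matrixP => j k; rewrite !mxE (gE (j, k)) ratr_int.
rewrite det_map_mx fmorph_eq0; apply/negP => /det0P[v v0 vG].
pose x := (qmx v *m b) 0 0.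
have x0 : x != 0.
  apply: contraNneq v0 => /= x0; apply/eqP/rowP => i; rewrite [RHS]mxE.
  move/freeP: fb; apply; rewrite -[RHS]x0 /x mxE; apply: eq_bigr => j _.
  by rewrite !mxE mulr_algl (nth_mktuple (fun i => b i 0)).
have Txb k : Tr (x * b k 0) = 0.
  rewrite /x mxE mulr_suml Tr_sum; move/matrixP/(_ 0 k): vG.
  rewrite !mxE => /(congr1 (ratr : rat -> algC)); rewrite rmorph0.
  apply: eq_trans; rewrite rmorph_sum; apply: eq_bigr => j _.
  by rewrite [G _ _]mxE !mxE -mulrA mulr_algl TrZ (gE (j, k)) rmorphM /= ratr_int.
have [c cE] := span_of_free fb x^-1.
have : Tr (x * x^-1) = 0.
  rewrite cE mxE mulr_sumr Tr_sum big1 // => k _.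
  by rewrite mxE mulrCA mulr_algl TrZ Txb mulr0.
by rewrite divff // Tr1 => /eqP; rewrite pnatr_eq0 gtn_eqF ?adim_gt0.
Qed.

(** Clearing denominators in a Q-basis of L gives one made of algebraic integers; it need not
    generate O_L over Z. *)
Lemma integral_basis_exists :
  exists b, (forall i, in_OL (b i 0)) /\ \det (embed b) != 0.
Proof.
pose e := vbasis {:L}.
have /choice[D DP] (i : 'I_d) : exists D : nat, (0 < D)%N /\ in_OL (D%:R * e`_i).
  by have [D] := in_OL_denominator e`_i; exists D.
pose b := \col_i ((D i)%:R * e`_i) : 'cV[L]_d; exists b.
have Ob i : in_OL (b i 0) by rewrite mxE; case: (DP i).
split=> //; apply: disc_neq0 => //; apply/freeP => k kb i.
have /freeP fe := basis_free (vbasisP {:L}).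
suff /eqP : k i * (D i)%:R = 0.
  rewrite mulf_eq0 pnatr_eq0.
  by case: (DP i) => /lt0n_neq0/negPf-> _; rewrite orbF => /eqP.
apply: (fe (fun i => k i * (D i)%:R)); rewrite -[RHS]kb; apply: eq_bigr => j _.
by rewrite (nth_mktuple (fun i => b i 0)) mxE mulr_natl -scalerA scaler_nat.
Qed.

(* Minimise the discriminant: a fractional coordinate q of an element of I
   would allow an exchange multiplying the discriminant by q^2 < 1. *)
Lemma lattice_basis (I : L -> Prop) (m : nat) :
  is_ideal I -> (0 < m)%N -> I m%:R ->
  exists b, [/\ forall i, I (b i 0), \det (embed b) != 0 &
    forall x, I x -> exists c : 'rV[int]_d, x = (zmx c *m b) 0 0].
Proof.
move=> iI m_gt0 Im.
pose P n := `[< exists b, [/\ forall i, I (b i 0), \det (embed b) != 0 &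
  exists z : int, \det (embed b) ^+ 2 = z%:~R /\ `|z|%N = n] >].
have exP : exists n, P n.
  have [b [Ob b0]] := integral_basis_exists.
  (* Scaling by m, which lies in I, moves a basis of algebraic integers into I. *)
  pose b' := m%:R *: b.
  have Ib' i : I (b' i 0) by rewrite mxE mulrC; apply: idealM.
  have [z zE] := disc_int (fun i => ideal_sub iI (Ib' i)).
  exists `|z|%N; apply/asboolP; exists b'; split=> //; last by exists z.
  apply: disc_neq0 => [i|]; first exact: ideal_sub iI _.
  apply/freeP => k kb i; have /freeP fb := free_of_disc b0.
  suff /eqP : k i * m%:R = 0.
    by rewrite mulf_eq0 pnatr_eq0 (gtn_eqF m_gt0) orbF => /eqP.
  apply: (fb (fun i => k i * m%:R)); rewrite -[RHS]kb; apply: eq_bigr => j _.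
  rewrite (nth_mktuple (fun i => b' i 0)) (nth_mktuple (fun i => b i 0)) mxE.
  by rewrite mulr_natl -scalerA scaler_nat.
case: (ex_minnP exP) => n /asboolP[b [Ib b0 [z [zE zn]]]] minn.
exists b; split=> // x Ix; have [c cE] := span_of_free (free_of_disc b0) x.
pose f : 'rV[int]_d := map_mx Num.floor c; exists f.
pose q := c - zmx f.
have xE : x - (zmx f *m b) 0 0 = (qmx q *m b) 0 0.
  by rewrite cE zmx_qmx map_mxB mulmxBl !mxE.
suff q0 : q = 0.
  by apply/eqP; rewrite -subr_eq0 xE q0 map_mx0 mul0mx mxE.
apply/rowP => i; rewrite [RHS]mxE; apply/eqP; apply: contraT => qi0.
have /andP[qi_ge0 qi_lt1] : 0 <= q 0 i < 1.
  rewrite !mxE subr_ge0 floor_le ltrBlDl -[X in _ < _ + X]/(1%:~R) -intrD.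
  exact: floorD1_gt.
have qi_gt0 : 0 < q 0 i by rewrite lt_def qi0.
(* The exchange replaces b_i by the remainder of x, whose coordinates are q. *)
pose M := \matrix_(j, k) (if j == i then q 0 k else (j == k)%:R).
pose b' := qmx M *m b.
have b'E : embed b' = embed b *m (map_mx ratr M)^T by rewrite embedM.
have detb' : \det (embed b') = \det (embed b) * ratr (q 0 i).
  by rewrite b'E det_mulmx det_tr det_map_mx (det_row_unit i (fun k => q 0 k)).
have Ib' j : I (b' j 0).
  have [->|ji] := eqVneq j i.
    have -> : b' i 0 = (qmx q *m b) 0 0.
      by rewrite !mxE; apply: eq_bigr => k _; rewrite !mxE eqxx.
    rewrite -xE; apply: idealB => //; exact: ideal_mulmx.
  rewrite mxE (bigD1 j) //= big1 ?addr0 => [|k kj].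
    by rewrite !mxE (negPf ji) eqxx rmorph1 mul1r.
  by rewrite !mxE (negPf ji) eq_sym (negPf kj) rmorph0 mul0r.
have [z' zE'] := disc_int (fun i => ideal_sub iI (Ib' i)).
have z'z : z'%:~R = z%:~R * q 0 i ^+ 2.
  apply: (fmorph_inj (ratr : {rmorphism rat -> algC})).
  by rewrite rmorphM rmorphXn /= !ratr_int -zE' -zE detb' exprMn.
have : (n <= `|z'|)%N.
  apply: minn; apply/asboolP; exists b'; split=> //; last by exists z'.
  by rewrite detb' mulf_neq0 // fmorph_eq0.
rewrite leqNgt => /negP[]; rewrite -zn -(ltr_nat rat) !natr_absz !intr_norm z'z normrM.
rewrite normrX gtr_pMr ?normr_gt0 //; first by rewrite expr_lt1 // ger0_norm.
by have := expf_neq0 2 b0; rewrite zE !intr_eq0.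
Qed.

Lemma coord_unique b (c : 'rV[int]_d) :
  \det (embed b) != 0 -> zmx c *m b = 0 -> c = 0.
Proof.
move=> b0 cb; have /freeP fb := free_of_disc b0; apply/rowP => i.
rewrite [RHS]mxE; apply/eqP; rewrite -(intr_eq0 rat); apply/eqP.
apply: (fb (fun i => (c 0 i)%:~R)); move/matrixP/(_ 0 0): cb.
rewrite !mxE; apply: eq_trans; apply: eq_bigr => j _.
by rewrite (nth_mktuple (fun i => b i 0)) mxE scaler_int mulrzl.
Qed.

(** Applying sigma_i to x b = N b gives diag(sigma_i x) V = V N^T with V = [embed b]. *)
Lemma Tr_mxtrace b (N : 'M[int]_d) x :
  \det (embed b) != 0 -> x *: b = zmx N *m b -> Tr x = (\tr N)%:~R.
Proof.
move=> b0 xb; rewrite -mxtrace_tr -trace_map_mx.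
rewrite (trace_of_conjugate (D := \row_i sigma i x) b0).
  by apply: eq_bigr => i _; rewrite mxE.
have -> : zmx N^T = (map_mx ratr (zmx N))^T :> 'M[algC]_d.
  by apply/matrixP => i j; rewrite !mxE ratr_int.
rewrite -embedM -zmx_qmx -xb mul_diag_mx.
by apply/matrixP => i j; rewrite !mxE rmorphM.
Qed.

End Lattices.

(** * Traces on quotients of ideals modulo p *)

Section TraceModP.
Variables (L : fieldExtType rat) (p : nat).
Hypothesis p_pr : prime p.
Implicit Types (I J K P : L -> Prop) (x y : L).

Definition eqmod J m (u v : 'cV[L]_m) := forall i, J (u i 0 - v i 0).

(** Representatives in I of an ['F_p]-basis of I / J, with integer lifts of the coefficients. *)
Definition modbasis I J n (b : 'cV[L]_n) :=
  [/\ forall i, I (b i 0),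
      forall x, I x -> exists c : 'rV[int]_n, J (x - (zmx c *m b) 0 0)
    & forall c : 'rV[int]_n, J ((zmx c *m b) 0 0) -> zmx c = 0 :> 'rV['F_p]_n].

(* [trmod I J x t]: multiplication by [x] on the F_p-vector space [I / J] has trace [t]. *)
Definition trmod I J x (t : 'F_p) :=
  exists n (b : 'cV[L]_n) (N : 'M[int]_n),
    [/\ modbasis I J b, eqmod J (x *: b) (zmx N *m b) & t = (\tr N)%:~R].

Lemma intFp_eq0 (n : int) : ((n%:~R : 'F_p) == 0) = (p %| n)%Z.
Proof. by rewrite (dvdz_pcharf (pchar_Fp p_pr)). Qed.

Section Eqmod.
Variable J : L -> Prop.
Hypothesis iJ : is_ideal J.

Lemma eqmod_sym m (u v : 'cV[L]_m) : eqmod J u v -> eqmod J v u.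
Proof. by move=> uv i; rewrite -opprB; apply: idealN. Qed.

Lemma eqmod_trans m (u v w : 'cV[L]_m) : eqmod J u v -> eqmod J v w -> eqmod J u w.
Proof. by move=> uv vw i; rewrite -(subrKA (v i 0)); apply: idealD. Qed.

Lemma eqmod_mul m n (A : 'M[int]_(m, n)) (u v : 'cV[L]_n) :
  eqmod J u v -> eqmod J (zmx A *m u) (zmx A *m v).
Proof.
move=> uv i; have -> : (zmx A *m u) i 0 - (zmx A *m v) i 0 = (zmx A *m (u - v)) i 0.
  by rewrite mulmxBr !mxE.
by apply: ideal_mulmx => // j; rewrite !mxE; apply: uv.
Qed.

Lemma eqmod_scale m x (u v : 'cV[L]_m) :
  in_OL x -> eqmod J u v -> eqmod J (x *: u) (x *: v).
Proof. by move=> Ox uv i; rewrite !mxE -mulrBr; apply: idealM. Qed.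

Lemma modbasis_coord I n (b : 'cV[L]_n) m (u : 'cV[L]_m) :
  modbasis I J b -> (forall i, I (u i 0)) ->
  exists A : 'M[int]_(m, n), eqmod J u (zmx A *m b).
Proof.
case=> _ bS _ Iu; have /choice[c cP] i := bS _ (Iu i).
exists (\matrix_i c i) => i; have -> : (zmx (\matrix_i c i) *m b) i 0 = (zmx (c i) *m b) 0 0.
  by rewrite !mxE; apply: eq_bigr => k _; rewrite !mxE.
exact: cP.
Qed.

Lemma modbasis_free I n (b : 'cV[L]_n) m (A B : 'M[int]_(m, n)) :
  modbasis I J b -> eqmod J (zmx A *m b) (zmx B *m b) ->
  zmx A = zmx B :> 'M['F_p]_(m, n).
Proof.
case=> _ _ bF AB; apply/row_matrixP => i; apply/eqP; rewrite -subr_eq0; apply/eqP.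
rewrite -!map_row -map_mxB; apply: bF; rewrite map_mxB mulmxBl !map_row -!row_mul.
by rewrite !mxE; have := AB i; rewrite !mxE.
Qed.

(** The transition matrices between the two bases are inverse modulo p and conjugate N into N'.
    Cyclicity of the trace for rectangular matrices avoids proving n = n' first. *)
Lemma trmod_unique I x t t' :
  (forall y, J y -> I y) -> in_OL x -> trmod I J x t -> trmod I J x t' -> t = t'.
Proof.
move=> JI Ox [n [b [N [bb xb ->]]]] [n' [b' [N' [bb' xb' ->]]]].
have [A bA] := modbasis_coord bb (let: And3 h _ _ := bb' in h).
have [A' bA'] := modbasis_coord bb' (let: And3 h _ _ := bb in h).
have AA' : zmx A *m zmx A' = 1%:M :> 'M['F_p]_n'.
  rewrite -map_mxM -(map_mx1 (intr : {rmorphism int -> 'F_p})).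
  apply: (modbasis_free bb'); apply: eqmod_sym; rewrite map_mx1 mul1mx.
  apply: (eqmod_trans bA); rewrite map_mxM -mulmxA; exact: eqmod_mul.
have A'A : zmx A' *m zmx A = 1%:M :> 'M['F_p]_n.
  rewrite -map_mxM -(map_mx1 (intr : {rmorphism int -> 'F_p})).
  apply: (modbasis_free bb); apply: eqmod_sym; rewrite map_mx1 mul1mx.
  apply: (eqmod_trans bA'); rewrite map_mxM -mulmxA; exact: eqmod_mul.
have NA : zmx (N' *m A) = zmx (A *m N) :> 'M['F_p]_(n', n).
  apply: (modbasis_free bb).
  apply: (@eqmod_trans _ _ (zmx N' *m b')).
    rewrite map_mxM -mulmxA; apply: eqmod_mul; exact: eqmod_sym.
  apply: (eqmod_trans (eqmod_sym xb')).
  apply: (eqmod_trans (eqmod_scale Ox bA)).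
  rewrite scalemxAr map_mxM -mulmxA; exact: eqmod_mul.
rewrite -!trace_map_mx -[zmx N]mul1mx -A'A -mulmxA -map_mxM -NA map_mxM.
by rewrite mxtrace_mulC -mulmxA AA' mulmx1.
Qed.

End Eqmod.

Lemma trmod_trivial I x : is_ideal I -> trmod I I x 0.
Proof.
move=> iI; exists 0%N, 0, 0; split; last by rewrite mxtrace0.
  split=> [[]//|y Iy|c _]; last by apply/rowP; case.
  by exists 0; rewrite !mxE big_ord0 subr0.
by case.
Qed.

(** A basis of I / J followed by one of J / K is a basis of I / K, in which multiplication by x is
    block triangular. *)
Lemma trmod_cat I J K x t1 t2 : is_ideal I -> is_ideal J -> is_ideal K ->
  (forall y, K y -> J y) -> (forall y, J y -> I y) ->
  (forall y, I y -> K (p%:R * y)) -> in_OL x ->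
  trmod I J x t1 -> trmod J K x t2 -> trmod I K x (t1 + t2).
Proof.
move=> iI iJ iK KJ JI pI Ox [n1 [b1 [N1 [bb1 xb1 ->]]]] [n2 [b2 [N2 [bb2 xb2 ->]]]].
have [I1 S1 F1] := bb1; have [J2 S2 F2] := bb2.
have [X XP] : exists X : 'M[int]_(n1, n2),
    eqmod K (x *: b1 - zmx N1 *m b1) (zmx X *m b2).
  apply: (modbasis_coord bb2) => i; have := xb1 i.
  by rewrite !mxE.
have rcE (c1 : 'rV[int]_n1) (c2 : 'rV[int]_n2) :
    (zmx (row_mx c1 c2) *m col_mx b1 b2) 0 0 = (zmx c1 *m b1) 0 0 + (zmx c2 *m b2) 0 0.
  by rewrite map_row_mx mul_row_col mxE.
exists (n1 + n2)%N, (col_mx b1 b2), (block_mx N1 X 0 N2); split.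
- split=> [i|y Iy|c].
  + by rewrite -[i]splitK; case: split => j /=; rewrite ?col_mxEu ?col_mxEd //; apply: JI.
  + have [c1 c1P] := S1 y Iy; have [c2 c2P] := S2 _ c1P.
    by exists (row_mx c1 c2); rewrite rcE opprD addrA.
  + rewrite -[c]hsubmxK; move: (lsubmx c) (rsubmx c) => c1 c2.
    rewrite rcE => Kc.
    have J2c : J ((zmx c2 *m b2) 0 0) by apply: ideal_mulmx.
    have c10 : zmx c1 = 0 :> 'rV['F_p]_n1.
      apply: F1; rewrite -[X in J X](addrK ((zmx c2 *m b2) 0 0)).
      by apply: idealB => //; apply: KJ.
    (* The coefficients c1 are divisible by p and p I lies in K; hence the J-part of the relation
       lies in K as well. *)
    have Kc1 : K ((zmx c1 *m b1) 0 0).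
      rewrite mxE; apply: ideal_sum => // i _; rewrite mxE.
      move/rowP/(_ i)/eqP: c10; rewrite !mxE intFp_eq0 => /dvdzP[q ->].
      rewrite intrM -mulrA; apply: idealM => //; first exact: in_OL_int.
      by apply: pI.
    rewrite map_row_mx c10 F2 ?row_mx0 //.
    rewrite -[X in K X](addKr ((zmx c1 *m b1) 0 0)).
    by apply: idealD => //; apply: idealN.
- move=> i; rewrite scale_col_mx map_block_mx mul_block_col map_mx0 mul0mx add0r.
  rewrite -[i]splitK; case: split => j /=; rewrite ?col_mxEu ?col_mxEd; last exact: xb2.
  have -> : (x *: b1) j 0 - (zmx N1 *m b1 + zmx X *m b2) j 0 =
      (x *: b1 - zmx N1 *m b1) j 0 - (zmx X *m b2) j 0.
    by rewrite !mxE opprD addrA.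
  exact: XP.
- by rewrite mxtrace_block intrD.
Qed.

(** The hypotheses make multiplication by a an isomorphism from O_L / P onto I / J. It commutes with
    multiplication by x, so the same N serves. *)
Lemma trmod_iso I J P a x t : is_ideal J ->
  (forall y, in_OL y -> I (a * y)) ->
  (forall y, I y -> exists2 z, in_OL z & J (y - a * z)) ->
  (forall y, in_OL y -> J (a * y) -> P y) -> (forall y, P y -> J (a * y)) ->
  trmod (@in_OL L) P x t -> trmod I J x t.
Proof.
move=> iJ Ia Isurj Jinj PJ [n [b [N [[bO bS bF] xb ->]]]].
have aE (c : 'rV[int]_n) : (zmx c *m (a *: b)) 0 0 = a * (zmx c *m b) 0 0.
  by rewrite -scalemxAr mxE.
exists n, (a *: b), N; split=> //; first split=> [i|y Iy|c].
- by rewrite mxE; apply: Ia.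
- have [z Oz yz] := Isurj y Iy; have [c cP] := bS z Oz; exists c.
  rewrite aE -(subrKA (a * z)); apply: idealD => //; rewrite -mulrBr; exact: PJ.
- rewrite aE => Jc; apply: bF; apply: Jinj => //; apply: ideal_mulmx => //.
  exact: is_ideal_OL.
- move=> i; have := PJ _ (xb i); rewrite -scalemxAr mulrBr !mxE.
  by rewrite mulrCA.
Qed.

Lemma modbasis_exists I J d (b0 : 'cV[L]_d) :
  is_ideal I -> is_ideal J -> (forall y, I y -> J (p%:R * y)) ->
  (forall i, I (b0 i 0)) ->
  (forall x, I x -> exists c : 'rV[int]_d, x = (zmx c *m b0) 0 0) ->
  exists n (b : 'cV[L]_n), modbasis I J b.
Proof.
move=> iI iJ pI Ib0 b0S.
pose S n := `[< exists b : 'cV[L]_n, (forall i, I (b i 0)) /\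
  forall x, I x -> exists c : 'rV[int]_n, J (x - (zmx c *m b) 0 0) >].
have exS : exists n, S n.
  exists d; apply/asboolP; exists b0; split=> // x Ix; have [c ->] := b0S x Ix.
  by exists c; rewrite subrr; apply: ideal0.
case: (ex_minnP exS) => n /asboolP[b [Ib bS]] minn.
exists n, b; split=> // c Jc; apply/eqP; apply: contraT => c0.
have [j cj] : exists j, ~~ (p %| c 0%R j)%Z.
  apply/existsP; rewrite -negb_forall; apply: contra c0 => /forallP c0.
  by apply/eqP/rowP => j; rewrite !mxE; apply/eqP; rewrite intFp_eq0.
case: n => [|n] in b Ib bS c Jc c0 j cj minn *; first by case: (j).
(* u inverts c_j modulo p, so the relation c expresses b_j through the other generators. *)
have [u uP] : exists u : int, (p %| (1 - u * c 0 j)%R)%Z.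
  have : coprimez p (c 0 j) by rewrite coprimezE prime_coprime.
  rewrite /coprimez; have [u [v <-]] := Bezoutz p (c 0 j) => /eqP uv1.
  by exists v; rewrite -uv1 addrK dvdz_mull.
have := minn n; rewrite ltnn => -> //; apply/asboolP.
exists (\col_i b (lift j i) 0); split=> [i|x Ix]; first by rewrite mxE.
have [a xa] := bS x Ix.
exists (\row_i (a 0 (lift j i) - a 0 j * u * c 0 (lift j i))).
suff : J ((zmx a *m b) 0 0 -
   (zmx (\row_i (a 0 (lift j i) - a 0 j * u * c 0 (lift j i))) *m
     (\col_i b (lift j i) 0)) 0 0).
  by move=> Ja; rewrite -(subrKA ((zmx a *m b) 0 0)); apply: idealD.
(* Both terms on the right lie in J: p divides 1 - u c_j and p I lies in J, while c is a relation
   modulo J. *)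
have -> : (zmx a *m b) 0 0 -
   (zmx (\row_i (a 0 (lift j i) - a 0 j * u * c 0 (lift j i))) *m
     (\col_i b (lift j i) 0)) 0 0 =
  (a 0 j)%:~R * ((1 - u * c 0 j)%:~R * b j 0 + u%:~R * (zmx c *m b) 0 0).
  rewrite !mxE !(bigD1_ord j) //= !mxE.
  under [X in _ - X]eq_bigr do rewrite !mxE intrB !intrM mulrBl.
  under [X in _ + X - _]eq_bigr do rewrite mxE.
  rewrite sumrB opprB addrCA addrK addrC.
  rewrite intrB intrM.
  have -> : \sum_(i < n) (a 0 j)%:~R * u%:~R * (c 0 (lift j i))%:~R * b (lift j i) 0 =
      (a 0 j)%:~R * u%:~R * \sum_(i < n) zmx c 0 (lift j i) * b (lift j i) 0.
    by rewrite mulr_sumr; apply: eq_bigr => i _; rewrite mxE mulrA.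
  by ring.
apply: idealM => //; first exact: in_OL_int.
apply: idealD => //; last by apply: idealM => //; apply: in_OL_int.
have /dvdzP[q ->] := uP; rewrite intrM -mulrA; apply: idealM => //.
  exact: in_OL_int.
by apply: pI.
Qed.

Lemma trmod_exists I J d (b0 : 'cV[L]_d) x :
  is_ideal I -> is_ideal J -> (forall y, I y -> J (p%:R * y)) ->
  (forall i, I (b0 i 0)) ->
  (forall x, I x -> exists c : 'rV[int]_d, x = (zmx c *m b0) 0 0) ->
  in_OL x -> exists t, trmod I J x t.
Proof.
move=> iI iJ pI Ib0 b0S Ox; have [n [b bb]] := modbasis_exists iI iJ pI Ib0 b0S.
have [N NP] := modbasis_coord (u := x *: b) bb
  (fun i => eq_ind_r I (idealM iI Ox (let: And3 h _ _ := bb in h i)) (mxE _ _ i 0)).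
by exists (\tr N)%:~R, n, b, N.
Qed.

End TraceModP.

(** * Ideal products and factorization *)

Section IdealProducts.
Variable L : fieldExtType rat.
Implicit Types (I J K P : L -> Prop) (x y : L).

(** Extensionality of predicates gives Leibniz equality, so ideals can be rewritten. *)
Lemma ideal_ext I J : ideal_eq I J -> I = J.
Proof. by move=> IJ; apply/predeqP. Qed.

Lemma ideal_mul_in I J x y : I x -> J y -> ideal_mul I J (x * y).
Proof.
by move=> Ix Jy; exists 1%N, (fun=> x), (fun=> y); split=> //; rewrite big_ord1.
Qed.

Lemma ideal_mul_ind I J K : K 0 -> (forall x y, K x -> K y -> K (x + y)) ->
  (forall x y, I x -> J y -> K (x * y)) -> forall z, ideal_mul I J z -> K z.
Proof.
move=> K0 KD KM z [n [u [v [uv ->]]]]; apply: (big_ind K) => // i _.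
by apply: KM; case: (uv i).
Qed.

Lemma ideal_mul0 I J : ideal_mul I J 0.
Proof. by exists 0%N, (fun=> 0), (fun=> 0); split=> [[]//|]; rewrite big_ord0. Qed.

Lemma ideal_mulD I J x y : ideal_mul I J x -> ideal_mul I J y -> ideal_mul I J (x + y).
Proof.
move=> [n [u [v [uv ->]]]] [n' [u' [v' [uv' ->]]]].
exists (n + n')%N, (fun i => match split i with inl j => u j | inr j => u' j end),
  (fun i => match split i with inl j => v j | inr j => v' j end); split.
  by move=> i; case: split.
rewrite big_split_ord; congr (_ + _); apply: eq_bigr => i _.
  by rewrite -[lshift _ _]/(unsplit (inl i)) unsplitK.
by rewrite -[rshift _ _]/(unsplit (inr i)) unsplitK.
Qed.

Lemma ideal_mul_sub I J K : is_ideal K -> (forall x y, I x -> J y -> K (x * y)) ->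
  forall z, ideal_mul I J z -> K z.
Proof.
by move=> iK; apply: ideal_mul_ind => [|x y]; [exact: ideal0 | exact: idealD].
Qed.

Lemma ideal_mulS I J I' J' : (forall x, I x -> I' x) -> (forall x, J x -> J' x) ->
  forall z, ideal_mul I J z -> ideal_mul I' J' z.
Proof.
move=> II JJ; apply: ideal_mul_ind; [exact: ideal_mul0|exact: ideal_mulD|].
by move=> x y Ix Jy; apply: ideal_mul_in; [apply: II|apply: JJ].
Qed.

Lemma ideal_mulC : commutative (@ideal_mul L).
Proof.
suff h I J z : ideal_mul I J z -> ideal_mul J I z.
  by move=> I J; apply: ideal_ext => z; split; apply: h.
apply: ideal_mul_ind; [exact: ideal_mul0|exact: ideal_mulD|].
by move=> x y Ix Jy; rewrite mulrC; apply: ideal_mul_in.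
Qed.

Lemma ideal_mulA : associative (@ideal_mul L).
Proof.
have h I J K z : ideal_mul I (ideal_mul J K) z -> ideal_mul (ideal_mul I J) K z.
  apply: ideal_mul_ind; [exact: ideal_mul0|exact: ideal_mulD|] => x y Ix.
  apply: (ideal_mul_ind (K := fun y => _ (x * y))).
  - by rewrite mulr0; apply: ideal_mul0.
  - by move=> u v; rewrite mulrDr; apply: ideal_mulD.
  - by move=> u v Ju Kv; rewrite mulrA; do 2!apply: ideal_mul_in => //.
move=> I J K; apply: ideal_ext => z; split; first exact: h.
by rewrite ideal_mulC [ideal_mul I J]ideal_mulC => /h; rewrite ideal_mulC [ideal_mul K J]ideal_mulC.
Qed.

(** This lets [perm_big] reorder products of ideals. The law is a semigroup and not a monoid, since
    [in_OL] is neutral on ideals but not on arbitrary predicates. *)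
HB.instance Definition _ :=
  SemiGroup.isComLaw.Build (L -> Prop) (@ideal_mul L) ideal_mulA ideal_mulC.

Lemma ideal_mul_OL I : is_ideal I -> ideal_mul (@in_OL L) I = I.
Proof.
move=> iI; apply: ideal_ext => z; split=> [|Iz].
  by apply: ideal_mul_sub => // x y; apply: idealM.
by rewrite -[z]mul1r; apply: ideal_mul_in => //; apply: in_OL1.
Qed.

Lemma is_ideal_mul I J : is_ideal I -> is_ideal J -> is_ideal (ideal_mul I J).
Proof.
move=> iI iJ; split; [|exact: ideal_mul0|exact: ideal_mulD|].
  apply: ideal_mul_sub; first exact: is_ideal_OL.
  by move=> x y Ix Jy; apply: in_OLM; [apply: ideal_sub Ix|apply: ideal_sub Jy].
move=> u z Ou; apply: (ideal_mul_ind (K := fun z => _ (u * z))).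
- by rewrite mulr0; apply: ideal_mul0.
- by move=> x y; rewrite mulrDr; apply: ideal_mulD.
- by move=> x y Ix Jy; rewrite mulrA; apply: ideal_mul_in => //; apply: idealM.
Qed.

Lemma is_ideal_prime P : prime_ideal P -> is_ideal P.
Proof. by case. Qed.

Lemma is_ideal_principal p : is_ideal (@principal_nat L p).
Proof.
split=> [x [y [Oy ->]]||x y [u [Ou ->]] [v [Ov ->]]|u x Ou [y [Oy ->]]].
- by apply: in_OLM => //; apply: in_OL_nat.
- by exists 0; rewrite mulr0; split=> //; apply: in_OL0.
- by exists (u + v); rewrite mulrDr; split=> //; apply: in_OLD.
- by exists (u * y); rewrite mulrCA; split=> //; apply: in_OLM.
Qed.

Lemma principal_self p : @principal_nat L p p%:R.
Proof. by exists 1; rewrite mulr1; split=> //; apply: in_OL1. Qed.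

Lemma principal_sub p I : is_ideal I -> I p%:R -> forall x, @principal_nat L p x -> I x.
Proof. by move=> iI Ip x [y [Oy ->]]; rewrite mulrC; apply: idealM. Qed.

Lemma mul_principal p K x : is_ideal K ->
  ideal_mul (@principal_nat L p) K x <-> exists2 k, K k & x = p%:R * k.
Proof.
move=> iK; split=> [|[k Kk ->]]; last first.
  by apply: ideal_mul_in => //; apply: principal_self.
move: x; apply: ideal_mul_ind.
- by exists 0; rewrite ?mulr0 //; apply: ideal0.
- by move=> x y [u Ku ->] [v Kv ->]; exists (u + v); rewrite ?mulrDr //; apply: idealD.
- by move=> x y [u [Ou ->]] Ky; exists (u * y); rewrite ?mulrA //; apply: idealM.
Qed.

Definition ideal_prod (l : seq (L -> Prop)) := foldr (@ideal_mul L) (@in_OL L) l.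

Lemma ideal_pow_prod I n : ideal_pow I n = ideal_prod (nseq n I).
Proof. by elim: n => //= n <-. Qed.

(** [{classic _}] gives predicates the boolean equality that membership, [perm_eq], [undup] and
    [count_mem] require. *)
Lemma ideal_prod_perm (l l' : seq {classic (L -> Prop)}) :
  perm_eq l l' -> ideal_prod l = ideal_prod l'.
Proof. by move=> ll'; rewrite /ideal_prod !foldrE; apply: perm_big. Qed.

Implicit Types l : seq {classic (L -> Prop)}.

Lemma is_ideal_prod l : {in l, forall I : {classic (L -> Prop)}, is_ideal I} ->
  is_ideal (ideal_prod l).
Proof.
elim: l => [_|I l IHl il] /=; first exact: is_ideal_OL.
apply: is_ideal_mul; first by apply: il; rewrite mem_head.
by apply: IHl => J Jl; apply: il; rewrite inE Jl orbT.
Qed.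

Lemma ideal_prod_cat l l' : {in l', forall I : {classic (L -> Prop)}, is_ideal I} ->
  ideal_prod (l ++ l') = ideal_mul (ideal_prod l) (ideal_prod l').
Proof.
move=> il'; elim: l => [|I l IHl] /=; first by rewrite ideal_mul_OL //; apply: is_ideal_prod.
by rewrite IHl ideal_mulA.
Qed.

Lemma ideal_prod_sub l (I : {classic (L -> Prop)}) :
  {in l, forall I : {classic (L -> Prop)}, is_ideal I} ->
  I \in l -> forall x, ideal_prod l x -> I x.
Proof.
move=> il Il x; rewrite (ideal_prod_perm (perm_to_rem Il)) /= => h.
move: x h; apply: ideal_mul_sub; first exact: il.
move=> x y Ix lx; apply: idealMr => //; first exact: il.
apply: ideal_sub lx; apply: is_ideal_prod => J /mem_rem; exact: il.
Qed.

Lemma ideal_prod_pows n (P : 'I_n -> {classic (L -> Prop)}) (e : 'I_n -> nat) r :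
  (forall i, is_ideal (P i)) ->
  ideal_prod (flatten [seq nseq (e i) (P i) | i <- r]) =
  foldr (@ideal_mul L) (@in_OL L) [seq ideal_pow (P i) (e i) | i <- r].
Proof.
move=> iP; elim: r => //= i r <-; rewrite ideal_prod_cat ?ideal_pow_prod //.
by move=> I /flattenP[_ /mapP[j _ ->]]; rewrite mem_nseq => /andP[_ /eqP->].
Qed.

End IdealProducts.

(** * Finiteness modulo p and factorization of the ideals containing p *)

Section Finiteness.
Variables (L : fieldExtType rat) (d p : nat).
Hypothesis p_pr : prime p.
Hypothesis lattice : forall I : L -> Prop, is_ideal I ->
  forall m, (0 < m)%N -> I m%:R -> exists b : 'cV[L]_d,
    (forall i, I (b i 0)) /\ forall x, I x -> exists c : 'rV[int]_d, x = (zmx c *m b) 0 0.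
Implicit Types (I J K P : L -> Prop) (x y z : L).
Local Notation pO := (@principal_nat L p).

Lemma p_neq0 : p%:R != 0 :> L.
Proof.
have := fmorph_eq0 (in_alg L) (p%:R : rat); rewrite rmorph_nat pnatr_eq0 => ->.
by rewrite -lt0n prime_gt0.
Qed.

Lemma principal_ofFp n (b : 'cV[L]_n) (c c' : 'rV[int]_n) :
  (forall i, in_OL (b i 0)) -> zmx c = zmx c' :> 'rV['F_p]_n ->
  pO ((zmx c *m b) 0 0 - (zmx c' *m b) 0 0).
Proof.
move=> Ob cc'; rewrite !mxE -sumrB; apply: ideal_sum => [|i _].
  exact: is_ideal_principal.
rewrite -mulrBl !mxE -intrB; move/rowP/(_ i)/eqP: cc'.
rewrite !mxE -subr_eq0 -intrB (intFp_eq0 p_pr) => /dvdzP[q ->].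
exists (q%:~R * b i 0); split; first by apply: in_OLM => //; apply: in_OL_int.
by rewrite intrM mulrCA mulrA.
Qed.

(** Pigeonhole on the coordinates modulo p of the powers of x. *)
Lemma power_cycle x : in_OL x ->
  exists k m, (0 < m)%N /\ pO (x ^+ k - x ^+ (k + m)).
Proof.
move=> Ox; have [b [Ob bS]] := lattice (is_ideal_OL L) (ltn0Sn 0) (in_OL1 L).
have /choice[c cE] k := bS _ (in_OLX k Ox).
pose N := #|{: 'rV['F_p]_d}|.
pose f (k : 'I_N.+1) : 'rV['F_p]_d := zmx (c k).
have /injectivePn[k [l kl fkl]] : ~~ injectiveb f.
  apply/negP => /injectiveP/leq_card; rewrite card_ord ltnn //.
wlog lt_kl : k l kl fkl / (k < l)%N.
  move=> wl; case: (ltngtP k l) => [kl'|lk|/ord_inj/eqP]; last by rewrite (negPf kl).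
    exact: (wl k l).
  by apply: (wl l k) => //; rewrite eq_sym.
exists k, (l - k)%N; rewrite subn_gt0 subnKC ?(ltnW lt_kl) //; split=> //.
by rewrite !cE; apply: principal_ofFp.
Qed.

Lemma prime_idealX P x n : prime_ideal P -> in_OL x -> P (x ^+ n) -> P x.
Proof.
move=> [iP _ P1 PM] Ox; elim: n => [|n IHn]; first by rewrite expr0 => /P1.
by rewrite exprS => /PM[] //; apply: in_OLX.
Qed.

(** P contains x^k (1 - x^m) but not x^k, so x^(m-1) inverts x modulo P. *)
Lemma prime_maximal P x : prime_ideal P -> P p%:R -> in_OL x -> ~ P x ->
  exists2 y, in_OL y & P (1 - y * x).
Proof.
move=> prP Pp Ox Px; have [k [m [m_gt0 pk]]] := power_cycle Ox.
have [iP _ P1 PM] := prP.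
have := principal_sub iP Pp pk; rewrite exprD -{1}[x ^+ k]mulr1 -mulrBr.
case/PM => [||/(prime_idealX prP Ox)//|]; first exact: in_OLX.
  by apply: in_OLB; [apply: in_OL1|apply: in_OLX].
rewrite -(prednK m_gt0) exprSr => h; exists (x ^+ m.-1) => //; exact: in_OLX.
Qed.

Lemma prime_inclusion_eq P Q : prime_ideal P -> prime_ideal Q -> P p%:R ->
  (forall x, P x -> Q x) -> ideal_eq P Q.
Proof.
move=> prP prQ Pp PQ x; split=> [/PQ//|Qx]; apply: contrapT => Px.
have iQ := is_ideal_prime prQ; have Ox := ideal_sub iQ Qx.
have [y Oy /PQ Qy] := prime_maximal prP Pp Ox Px.
case: prQ => _ _ Q1 _; apply: Q1; rewrite -(subrK (y * x) 1).
by apply: idealD => //; apply: idealM.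
Qed.

(* mu I counts the classes modulo p that meet I. *)
Lemma ideal_measure_exists : exists (N : nat) (mu : (L -> Prop) -> nat),
  (forall I, (mu I <= N)%N) /\
  forall I J, is_ideal I -> is_ideal J -> I p%:R -> (forall x, I x -> J x) ->
    ~ (forall x, J x -> I x) -> (mu I < mu J)%N.
Proof.
have [b [Ob bS]] := lattice (is_ideal_OL L) (ltn0Sn 0) (in_OL1 L).
pose S I := [set c : 'rV['F_p]_d |
  `[< exists2 c', zmx c' = c & I ((zmx c' *m b) 0 0) >]].
exists #|{: 'rV['F_p]_d}|, (fun I => #|S I|); split=> [I|I J iI iJ Ip IJ JI].
  exact: max_card.
apply: proper_card; rewrite properE; apply/andP; split.
  apply/subsetP => c; rewrite !inE => /asboolP[c' c'E Ic'].
  by apply/asboolP; exists c' => //; apply: IJ.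
have [x Jx Ix] : exists2 x, J x & ~ I x.
  by apply: contrapT => h; apply: JI => x Jx; apply: contrapT => Ix; apply: h; exists x.
have [c cE] := bS x (ideal_sub iJ Jx).
apply/negP => /subsetP/(_ (zmx c)); rewrite !inE => h.
have /asboolP[c' c'E Ic'] : `[< exists2 c', zmx c' = zmx c :> 'rV['F_p]_d &
    I ((zmx c' *m b) 0 0) >].
  by apply: h; apply/asboolP; exists c => //; rewrite -cE.
apply: Ix; rewrite cE -(subrK ((zmx c' *m b) 0 0) ((zmx c *m b) 0 0)).
apply: idealD => //; apply: (principal_sub iI Ip).
exact: principal_ofFp.
Qed.

(** Noetherian induction: passing to a strictly larger ideal decreases N - mu. *)
Lemma ideal_up_ind (Q : (L -> Prop) -> Prop) :
  (forall I, is_ideal I -> I p%:R ->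
    (forall J, is_ideal J -> (forall x, I x -> J x) -> ~ (forall x, J x -> I x) -> Q J) ->
    Q I) ->
  forall I, is_ideal I -> I p%:R -> Q I.
Proof.
move=> QP; have [N [mu [muN mu_lt]]] := ideal_measure_exists.
suff h n I : (N - mu I < n)%N -> is_ideal I -> I p%:R -> Q I.
  by move=> I; apply: (h (N - mu I).+1).
elim: n I => // n IHn I lt_n iI Ip; apply: QP => // J iJ IJ JI.
apply: IHn => //; last exact: IJ.
apply: leq_trans (_ : N - mu I <= n)%N; last by rewrite -ltnS.
by apply: ltn_sub2l; [apply: leq_trans (muN J); apply: mu_lt | apply: mu_lt].
Qed.

Definition adjoin I a : L -> Prop := fun z => exists u y, [/\ I u, in_OL y & z = u + y * a].

Lemma is_ideal_adjoin I a : is_ideal I -> in_OL a -> is_ideal (adjoin I a).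
Proof.
move=> iI Oa.
split=> [z [u [y [Iu Oy ->]]]||z z' [u [y [Iu Oy ->]]] [u' [y' [Iu' Oy' ->]]]
  |v z Ov [u [y [Iu Oy ->]]]].
- by apply: in_OLD; [apply: ideal_sub Iu|apply: in_OLM].
- exists 0, 0; rewrite mul0r addr0; split=> //; [exact: ideal0|exact: in_OL0].
- exists (u + u'), (y + y'); split; [exact: idealD|exact: in_OLD|].
  by rewrite mulrDl addrACA.
- exists (v * u), (v * y); split; [exact: idealM|exact: in_OLM|].
  by rewrite mulrDr mulrA.
Qed.

Lemma adjoin_sub I a x : I x -> adjoin I a x.
Proof. by exists x, 0; rewrite mul0r addr0; split=> //; apply: in_OL0. Qed.

Lemma adjoin_self I a : is_ideal I -> adjoin I a a.
Proof.
by exists 0, 1; rewrite mul1r add0r; split=> //; [apply: ideal0|apply: in_OL1].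
Qed.

(** When I has no proper enlargement, any x outside I gives 1 = u + v x with u in I; multiplying by
    y shows that x y in I forces y in I. *)
Lemma prime_above I : is_ideal I -> I p%:R -> ~ I 1 ->
  exists2 P, prime_ideal P & forall x, I x -> P x.
Proof.
move: I; apply: ideal_up_ind => I iI Ip IH I1.
have [[J [iJ IJ JI J1]]|maxI] :=
    lem (exists J, [/\ is_ideal J, forall x, I x -> J x, ~ (forall x, J x -> I x) & ~ J 1]).
  by have [P prP JP] := IH J iJ IJ JI J1; exists P => // x /IJ/JP.
exists I => //; split=> //; first by exists p%:R; split=> //; apply: p_neq0.
move=> x y Ox Oy Ixy; have [Ix|Ix] := lem (I x); [by left|right].
have [u [v [Iu Ov uv]]] : adjoin I x 1.
  apply: contrapT => A1; apply: maxI; exists (adjoin I x); split=> //.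
  - exact: is_ideal_adjoin.
  - by move=> z; apply: adjoin_sub.
  - by move=> h; apply: Ix; apply: h; apply: adjoin_self.
rewrite -[y]mul1r uv mulrDl -mulrA; apply: idealD => //.
  exact: idealMr.
exact: idealM.
Qed.

Definition annihilator x : L -> Prop := fun s => in_OL s /\ pO (s * x).

Lemma is_ideal_annihilator x : is_ideal (annihilator x).
Proof.
have iO := is_ideal_principal L p.
split=> [s []//||s t [Os ps] [Ot pt]|s t Os [Ot pt]].
- by split; [exact: in_OL0|rewrite mul0r; apply: ideal0].
- by split; [exact: in_OLD|rewrite mulrDl; apply: idealD].
- by split; [exact: in_OLM|rewrite -mulrA; apply: idealM].
Qed.

(* Choose x with Ann(x mod p) maximal among those contained in P; then Ann(x) = P. *)
Lemma prime_associated P : prime_ideal P -> P p%:R ->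
  exists x, [/\ in_OL x, ~ pO x & forall u, P u -> pO (u * x)].
Proof.
move=> prP Pp; have [iP _ P1 PM] := prP; have iO := is_ideal_principal L p.
suff h : forall I, is_ideal I -> I p%:R ->
    forall x, in_OL x -> (forall s, annihilator x s <-> I s) ->
      (forall s, annihilator x s -> P s) ->
    exists x, [/\ in_OL x, ~ pO x & forall u, P u -> pO (u * x)].
  apply: (h (annihilator 1) _ _ 1) => //; first exact: is_ideal_annihilator.
  - by split; [exact: in_OL_nat|rewrite mulr1; apply: principal_self].
  - exact: in_OL1.
  - by move=> s [_]; rewrite mulr1; apply: principal_sub.
apply: ideal_up_ind => I iI Ip IH x Ox annI annP.
have px : ~ pO x by move=> px; apply: P1; apply: annP; split; [exact: in_OL1|rewrite mul1r].
have [all|] := lem (forall u, P u -> pO (u * x)); first by exists x.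
move=> nall; have [a Pa pax] : exists2 a, P a & ~ pO (a * x).
  by apply: contrapT => h; apply: nall => u Pu; apply: contrapT => pux; apply: h; exists u.
have Oa := ideal_sub iP Pa.
(* If Ann(y x) is strictly larger than Ann(x) but still inside P, the induction hypothesis at y x
   concludes. *)
have step y : in_OL y -> (forall s, annihilator (y * x) s -> P s) ->
    (exists2 s, annihilator (y * x) s & ~ annihilator x s) ->
    exists x, [/\ in_OL x, ~ pO x & forall u, P u -> pO (u * x)].
  move=> Oy annyP [s As nAs].
  apply: (IH (annihilator (y * x)) _ _ _ (y * x)) => //.
  - exact: is_ideal_annihilator.
  - by move=> t /annI[Ot ptx]; split=> //; rewrite mulrCA; apply: idealM.
  - by move=> h; apply: nAs; apply/annI; apply: h.
  - exact: in_OLM.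
have [[s [Os Ps nle]]|annS] := lem (exists s, [/\ in_OL s, ~ P s &
    exists2 t, annihilator (s * x) t & ~ annihilator x t]).
  apply: (step s) => // t [Ot ptsx]; have [] // := PM t s Ot Os.
  by apply: annP; split; [apply: in_OLM|rewrite -mulrA].
have {}annS s t : in_OL s -> ~ P s -> annihilator (s * x) t -> annihilator x t.
  move=> Os Ps At; apply: contrapT => nAt; apply: annS.
  by exists s; split=> //; exists t.
(* If some t outside P killed a x, then a would kill t x, hence x by [annS]. *)
have annaP t : annihilator (a * x) t -> P t.
  move=> [Ot ptax]; apply: contrapT => Pt.
  have [|_ /pax//] := annS t a Ot Pt.
  by split=> //; rewrite mulrCA.
have [nle|anna] := lem (exists2 s, annihilator (a * x) s & ~ annihilator x s).
  exact: (step a).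
have {}anna s : annihilator (a * x) s -> annihilator x s.
  by move=> As; apply: contrapT => nAs; apply: anna; exists s.
(* a^k (1 - a^m) is in p O_L and 1 - a^m is outside P, so a^k kills x. As Ann(a x) is no larger than
   Ann(x), k descends to 0, which puts x in p O_L. *)
have [k [m [m_gt0 pk]]] := power_cycle Oa.
have Pm : ~ P (1 - a ^+ m).
  move=> Pm; apply: P1; rewrite -(subrK (a ^+ m) 1); apply: idealD => //.
  by rewrite -(prednK m_gt0) exprSr; apply: idealM => //; apply: in_OLX.
have {pk} : annihilator x (a ^+ k).
  apply: (annS (1 - a ^+ m)) => //.
    by apply: in_OLB; [exact: in_OL1|exact: in_OLX].
  split; first exact: in_OLX.
  by rewrite mulrA mulrBr mulr1 -exprD; apply: idealMr.
elim: k => [[_]|k IHk]; first by rewrite expr0 mul1r => /px.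
move=> [_ pk]; apply/IHk/anna; split; first exact: in_OLX.
by rewrite mulrA -exprSr.
Qed.

(** z acts on generators of I by an integer matrix, and these are not all zero because I contains
    p. *)
Lemma stable_in_OL I z : is_ideal I -> I p%:R -> (forall x, I x -> I (z * x)) ->
  in_OL z.
Proof.
move=> iI Ip zI; have [b [Ib bS]] := lattice iI (prime_gt0 p_pr) Ip.
have /choice[c cE] i := bS _ (zI _ (Ib i)).
apply: (@integral_eigen _ _ (\matrix_i c i) b).
  apply/eqP => b0; have [u /eqP] := bS _ Ip.
  by rewrite b0 mulmx0 mxE (negPf p_neq0).
apply/matrixP => i j; rewrite ord1 mxE cE !mxE.
by apply: eq_bigr => k _; rewrite !mxE.
Qed.

(** The ideal quotient (p O_L : P), which turns out to be p P^-1. *)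
Definition coideal P : L -> Prop := fun y => in_OL y /\ forall u, P u -> pO (y * u).

Lemma is_ideal_coideal P : is_ideal (coideal P).
Proof.
have iO := is_ideal_principal L p.
split=> [s []//||s t [Os ps] [Ot pt]|s t Os [Ot pt]].
- by split=> [|u _]; [exact: in_OL0|rewrite mul0r; apply: ideal0].
- split=> [|u Pu]; first exact: in_OLD.
  by rewrite mulrDl; apply: idealD; [|apply: ps|apply: pt].
- split=> [|u Pu]; first exact: in_OLM.
  by rewrite -mulrA; apply: idealM => //; apply: pt.
Qed.

Lemma coideal_p P : is_ideal P -> coideal P p%:R.
Proof.
move=> iP; split=> [|u Pu]; first exact: in_OL_nat.
by exists u; split=> //; apply: ideal_sub Pu.
Qed.

(* K / p intersected with the ring of integers *)
Definition over_p K : L -> Prop := fun w => in_OL w /\ K (p%:R * w).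

Lemma is_ideal_over_p K : is_ideal K -> is_ideal (over_p K).
Proof.
move=> iK; split=> [s []//||s t [Os ps] [Ot pt]|s t Os [Ot pt]].
- by split; [exact: in_OL0|rewrite mulr0; apply: ideal0].
- by split; [exact: in_OLD|rewrite mulrDr; apply: idealD].
- by split; [exact: in_OLM|rewrite mulrCA; apply: idealM].
Qed.

(* If no y in P' \ pO worked, y / p would stabilise an ideal without being integral. *)
Lemma over_p_grows P I : prime_ideal P -> P p%:R -> is_ideal I -> I p%:R ->
  (forall x, I x -> P x) ->
  ~ (forall w, over_p (ideal_mul I (coideal P)) w -> I w).
Proof.
move=> prP Pp iI Ip IP MI; have iO := is_ideal_principal L p.
have [y [Oy py yP]] := prime_associated prP Pp.
have cy : coideal P y by split=> // u /yP; rewrite mulrC.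
suff Oz : in_OL (y / p%:R).
  by apply: py; exists (y / p%:R); split=> //; rewrite mulrC divfK // p_neq0.
apply: (stable_in_OL iI) => // x Ix.
have [w [Ow wE]] := yP _ (IP _ Ix).
have -> : y / p%:R * x = w by rewrite mulrAC [y * x]mulrC wE mulrAC divff ?mul1r ?p_neq0.
by apply: MI; split=> //; rewrite -wE; apply: ideal_mul_in.
Qed.

(** [over_p (ideal_mul P (coideal P))] contains P and, by [over_p_grows], is not inside P.
    Maximality of P puts 1 in it, so p lies in the product. *)
Lemma prime_invertible P : prime_ideal P -> P p%:R ->
  ideal_mul P (coideal P) = pO.
Proof.
move=> prP Pp; have iP := is_ideal_prime prP; have iO := is_ideal_principal L p.
have iC := is_ideal_coideal P; have iPC := is_ideal_mul iP iC.
apply: ideal_ext => x; split.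
  by apply: ideal_mul_sub => // u v Pu [_ h]; rewrite mulrC; apply: h.
move: x; apply: principal_sub => //.
have iM := is_ideal_over_p iPC.
have [w Mw Pw] : exists2 w, over_p (ideal_mul P (coideal P)) w & ~ P w.
  apply: contrapT => h; apply: (over_p_grows prP Pp iP Pp (fun _ => id)) => w Mw.
  by apply: contrapT => Pw; apply: h; exists w.
have [u Ou Pu] := prime_maximal prP Pp (ideal_sub iM Mw) Pw.
have : over_p (ideal_mul P (coideal P)) 1.
  rewrite -(subrK (u * w) 1); apply: idealD => //; last exact: idealM.
  split; first exact: ideal_sub Pu.
  by rewrite mulrC; apply: ideal_mul_in => //; apply: coideal_p.
by case=> _; rewrite mulr1.
Qed.

Lemma prime_factorization I : is_ideal I -> I p%:R ->
  exists l : seq {classic (L -> Prop)},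
    {in l, forall P : {classic (L -> Prop)}, prime_ideal P} /\ I = ideal_prod l.
Proof.
move: I; apply: ideal_up_ind => I iI Ip IH.
have [I1|I1] := lem (I 1).
  exists [::]; split=> //; apply: ideal_ext => x; split; first exact: ideal_sub.
  by move=> Ox; rewrite -[x]mulr1; apply: idealM.
have [P prP IP] := prime_above iI Ip I1.
have iP := is_ideal_prime prP; have Pp := IP _ Ip.
have iC := is_ideal_coideal P; have PC := prime_invertible prP Pp.
(* J stands for I P^-1; it strictly contains I, and I = P J remains to be shown. *)
pose J := over_p (ideal_mul I (coideal P)).
have iJ : is_ideal J by apply: is_ideal_over_p; apply: is_ideal_mul.
have [||l [lP Jl]] := IH J iJ; first move=> x Ix.
- split; first exact: ideal_sub Ix.
  by rewrite mulrC; apply: ideal_mul_in => //; apply: coideal_p.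
- exact: over_p_grows.
have pK (K : L -> Prop) x : is_ideal K -> ideal_mul pO K (p%:R * x) -> K x.
  by move=> iK /(mul_principal _ _ iK)[k Kk /(mulfI p_neq0)->].
exists ((P : {classic (L -> Prop)}) :: l); split.
  by move=> Q; rewrite inE => /orP[/eqP->|/lP].
rewrite /= -/(ideal_prod l) -Jl; apply: ideal_ext => x; split; last first.
  apply: ideal_mul_sub => // {}x y Px [Oy py]; apply: pK => //.
  rewrite -PC -ideal_mulA [ideal_mul (coideal P) I]ideal_mulC mulrCA.
  exact: ideal_mul_in.
(* Elements of [ideal_mul I (coideal P)] are p times elements of J, so p x lies in p P J and p
   cancels. *)
move=> Ix; have : ideal_mul P (ideal_mul I (coideal P)) (p%:R * x).
  rewrite [ideal_mul I _]ideal_mulC ideal_mulA PC.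
  by apply: ideal_mul_in => //; apply: principal_self.
have iPJ := is_ideal_mul iP iJ.
suff h z : ideal_mul P (ideal_mul I (coideal P)) z ->
    exists2 s, ideal_mul P J s & z = p%:R * s.
  by case/h => s sPJ /(mulfI p_neq0)->.
move: z; apply: ideal_mul_ind.
- by exists 0; rewrite ?mulr0 //; apply: ideal0.
- by move=> _ _ [s Ps ->] [t Pt ->]; exists (s + t); rewrite ?mulrDr //; apply: idealD.
move=> u v Pu ICv; have [w [Ow vE]] : pO v.
  by rewrite -PC; apply: ideal_mulS ICv.
exists (u * w); last by rewrite vE mulrCA.
by apply: ideal_mul_in => //; split=> //; rewrite -vE.
Qed.

Lemma factorization_exists : exists s (P : 'I_s -> L -> Prop) e, is_factorization p P e.
Proof.
have [l [lP lE]] := prime_factorization (is_ideal_principal L p) (principal_self L p).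
pose P (i : 'I_(size (undup l))) : {classic (L -> Prop)} := tnth (in_tuple (undup l)) i.
have Pl i : P i \in l by rewrite -mem_undup; apply: mem_tnth.
exists (size (undup l)), P, (fun i => count_mem (P i) l); split.
- by move=> i; apply: lP.
- move=> i j ij /ideal_ext Pij; case/negP: ij.
  have := undup_uniq l; move/(@uniqP _ (P i))/(_ i j).
  rewrite !inE !ltn_ord => /(_ isT isT) h; apply/eqP/ord_inj/h.
  have <- : P i = nth (P i) (undup l) i := tnth_nth _ _ _.
  by have <- : P j = nth (P i) (undup l) j := tnth_nth _ _ _.
- by move=> i; rewrite -has_count has_pred1.
rewrite lE => x; suff -> : ideal_prod l = foldr (@ideal_mul L) (@in_OL L)
  [seq ideal_pow (P i) (count_mem (P i) l) | i <- enum 'I_(size (undup l))] by [].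
have il : {in l, forall I : {classic (L -> Prop)}, is_ideal I}.
  by move=> I /lP/is_ideal_prime.
rewrite -(ideal_prod_perm (perm_count_undup l)).
rewrite -(ideal_prod_pows (fun i => count_mem (P i) l)); last by move=> i; apply: il.
have Pundup : undup l = map P (enum 'I_(size (undup l))).
  exact: esym (map_tnth_enum (in_tuple (undup l))).
congr (ideal_prod (flatten _)).
by apply: etrans (congr1 _ Pundup) _; rewrite -map_comp.
Qed.

End Finiteness.

(** * Residue fields *)

Section IntegerSubtype.
Variable L : fieldExtType rat.
Definition OL : {pred L} := fun x => `[< in_OL x >].

Lemma OLP x : reflect (in_OL x) (x \in OL).
Proof. exact: asboolP. Qed.

Fact OL_subring : subring_closed OL.
Proof.
split=> [|x y /OLP Ox /OLP Oy|x y /OLP Ox /OLP Oy]; apply/OLP.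
- exact: in_OL1.
- exact: in_OLB.
- exact: in_OLM.
Qed.
HB.instance Definition _ := GRing.isSubringClosed.Build L OL OL_subring.

Record OLtype := MkOL { OLval : L; _ : OLval \in OL }.
HB.instance Definition _ := [isSub for OLval].
HB.instance Definition _ := [Choice of OLtype by <:].
HB.instance Definition _ := [SubChoice_isSubComNzRing of OLtype by <:].

End IntegerSubtype.

(** The morphisms v and f present O_L / P while hiding the subtype and the quotient: v has image
    O_L, and f has kernel v^-1(P). *)
Lemma residue_field (L : fieldExtType rat) (P : L -> Prop) : prime_ideal P ->
  (forall x, in_OL x -> ~ P x -> exists2 y, in_OL y & P (1 - y * x)) ->
  exists (R : comNzRingType) (K : fieldType) (v : {rmorphism R -> L})
    (f : {rmorphism R -> K}),
    (forall x, in_OL x <-> exists r, v r = x) /\ (forall r, f r = 0 <-> P (v r)).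
Proof.
move=> prP maxP; have iP := is_ideal_prime prP.
pose R : comNzRingType := OLtype L.
have OLv (r : R) : in_OL (val r) by apply/OLP; apply: valP.
pose S : {pred R} := fun r => `[< P (val r) >].
have S_ideal : idealr_closed S.
  split; rewrite ?unfold_in.
  - by apply/asboolP; rewrite rmorph0; apply: ideal0.
  - by apply/asboolP; rewrite rmorph1; case: prP.
  move=> r u w; rewrite !unfold_in => /asboolP Pu /asboolP Pw; apply/asboolP.
  have -> : val (r * u + w) = val r * val u + val w by [].
  by apply: idealD => //; apply: idealM => //; apply: OLv.
pose I : idealr R := HB.pack S (isIdealr.Build R S S_ideal).
pose Q : comNzRingType := {ideal_quot I}.
pose f : {rmorphism R -> Q} := \pi_Q%qT.
have f0 r : f r = 0 <-> P (val r).
  have e : `[< P (val (r - 0)) >] = (f r == f 0) := Quotient.idealrBE I r 0.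
  rewrite subr0 rmorph0 in e.
  split=> [/eqP|/asboolP]; first by rewrite -e => /asboolP.
  by rewrite e => /eqP.
(* The field structure asks for a total inverse with value 0 at 0. *)
have inv x : exists y : Q, (x != 0 -> y * x = 1) /\ (x = 0 -> y = 0).
  have [->|x0] := eqVneq x 0; first by exists 0.
  have xE : f (repr x) = x := reprK x.
  have nP : ~ P (val (repr x)) by move/f0; rewrite xE; apply/eqP.
  have [y /OLP Oy Py] := maxP _ (OLv _) nP.
  exists (f (Sub y Oy)); split=> [_|/eqP]; last by rewrite (negPf x0).
  apply/eqP; rewrite eq_sym -subr_eq0 -xE -(rmorph1 f) -rmorphM -rmorphB.
  by apply/eqP/f0.
have [inv' inv'P] := choice inv.
have mulVf (x : Q) : x != 0 -> inv' x * x = 1 := (inv'P x).1.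
have invr0 : inv' 0 = 0 by apply: (inv'P 0).2.
pose K : fieldType := HB.pack (GRing.ComNzRing.sort Q)
   (GRing.ComNzRing_isField.Build Q mulVf invr0).
exists R, K, (val : {rmorphism R -> L}), (f : {rmorphism R -> K}); split=> // x.
split=> [/OLP Ox|[r <-]]; last exact: OLv.
by exists (Sub x Ox).
Qed.

(** * Linearized polynomials and the trace of the residue field *)

Section LinearizedPolynomial.
Variables (K : idomainType) (p : nat).
Hypothesis pK : p \in [pchar K].
Let p_pr : prime p := pcharf_prime pK.

Lemma Frobenius_iter_sum i (I : finType) (z : I -> int) (x : I -> K) :
  (\sum_j (z j)%:~R * x j) ^+ (p ^ i) = \sum_j (z j)%:~R * x j ^+ (p ^ i).
Proof.
elim: i => [|i IHi]; first by rewrite expr1; apply: eq_bigr => j _; rewrite expr1.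
rewrite expnSr exprM IHi -(pFrobenius_autE pK) rmorph_sum; apply: eq_bigr => j _.
by rewrite rmorphM /= pFrobenius_aut_int pFrobenius_autE -exprM.
Qed.

Definition linearized n (c : 'rV[K]_n) : {poly K} := \sum_(i < n) c 0 i *: 'X^(p ^ i).

Lemma horner_linearized n (c : 'rV[K]_n) x :
  (linearized c).[x] = \sum_(i < n) c 0 i * x ^+ (p ^ i).
Proof. by rewrite horner_sum; apply: eq_bigr => i _; rewrite hornerZ hornerXn. Qed.

(* The F_p-span of x has p^n elements, more than the degree of [linearized c]. *)
Lemma linearized_nonroot n (c : 'rV[K]_n) (x : 'I_n -> K) :
  (forall z : 'rV[int]_n, \sum_j (z 0 j)%:~R * x j = 0 -> zmx z = 0 :> 'rV['F_p]_n) ->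
  c != 0 -> exists j, (linearized c).[x j] != 0.
Proof.
move=> xF c0; apply/existsP; rewrite -negb_forall; apply/negP => /forallP roots.
have p_gt1 := prime_gt1 p_pr.
have n_gt0 : (0 < n)%N by case: n c c0 {x xF roots} => // c /eqP[]; apply/rowP; case.
have l0 : linearized c != 0.
  apply: contraNneq c0 => /polyP l0; apply/eqP/rowP => i; rewrite mxE.
  have := l0 (p ^ i)%N; rewrite coef_sum coef0 => <-.
  rewrite (bigD1 i) //= big1 ?addr0 => [|j ji]; rewrite coefZ coefXn.
    by rewrite eqxx mulr1.
  by rewrite eqn_exp2l // (inj_eq val_inj) eq_sym (negPf ji) mulr0.
pose lift (z : 'rV['F_p]_n) : 'rV[int]_n := map_mx (fun a : 'F_p => (a : nat)%:Z) z.
have liftK z : zmx (lift z) = z by apply/rowP => j; rewrite !mxE -pmulrn natr_Zp.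
pose g (z : 'rV['F_p]_n) := \sum_j (lift z 0 j)%:~R * x j.
have g_inj : injective g.
  move=> z z' gz; apply/eqP; rewrite -subr_eq0 -[z]liftK -[z']liftK -map_mxB; apply/eqP/xF.
  apply/eqP; rewrite -[X in _ == X](subrr (g z)) {2}gz -sumrB; apply/eqP/eq_bigr => j _.
  by rewrite !mxE intrB mulrBl.
have := @max_poly_roots _ (linearized c) [seq g z | z : 'rV['F_p]_n] l0.
rewrite size_map -cardE card_mx card_Fp // mul1n map_inj_uniq ?enum_uniq //.
have -> : all (root (linearized c)) [seq g z | z : 'rV['F_p]_n].
  apply/allP => _ /mapP[z _ ->]; apply/eqP; rewrite horner_linearized.
  under eq_bigr do rewrite Frobenius_iter_sum mulr_sumr.
  rewrite exchange_big big1 // => j _; under eq_bigr do rewrite mulrCA.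
  have := roots j; rewrite horner_linearized => /eqP rj.
  by rewrite -mulr_sumr rj mulr0.
(* The exponents p^i are below p^n, so the size is at most p^n, too small for p^n distinct roots. *)
move=> /(_ isT isT); apply/negP; rewrite -leqNgt.
apply: leq_trans (size_sum _ _ _) _; apply/bigmax_leqP => i _.
apply: leq_trans (size_scale_leq _ _) _; rewrite size_polyXn.
by rewrite ltn_exp2l.
Qed.

End LinearizedPolynomial.

(* The trace of the residue field is sum_i y^(p^i), and this polynomial cannot
   vanish identically. *)
Lemma residue_trace_neq0 (L : fieldExtType rat) p (P : L -> Prop) n (b : 'cV[L]_n) :
  prime p -> prime_ideal P -> P p%:R ->
  (forall x, in_OL x -> ~ P x -> exists2 y, in_OL y & P (1 - y * x)) ->
  modbasis p (@in_OL L) P b ->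
  exists y t, [/\ in_OL y, trmod (@in_OL L) P y t & t != 0 :> 'F_p].
Proof.
move=> p_pr prP Pp maxP bb; have [Ob bS bF] := bb; have iP := is_ideal_prime prP.
have [R [K [v [f [vP f0]]]]] := residue_field prP maxP.
have /choice[r rE] i := (vP _).1 (Ob i).
have pK : p \in [pchar K].
  by rewrite inE p_pr -(rmorph_nat f); apply/eqP/f0; rewrite rmorph_nat.
have vsum (z : 'rV[int]_n) : v (\sum_j (z 0 j)%:~R * r j) = (zmx z *m b) 0 0.
  rewrite rmorph_sum mxE; apply: eq_bigr => j _.
  by rewrite rmorphM /= rmorph_int rE mxE.
have fsum (z : 'rV[int]_n) : f (\sum_j (z 0 j)%:~R * r j) = \sum_j (z 0 j)%:~R * f (r j).
  by rewrite rmorph_sum; apply: eq_bigr => j _; rewrite rmorphM /= rmorph_int.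
pose x j := f (r j).
have xF (z : 'rV[int]_n) : \sum_j (z 0 j)%:~R * x j = 0 -> zmx z = 0 :> 'rV['F_p]_n.
  by rewrite -fsum => /f0; rewrite vsum; apply: bF.
have n_gt0 : (0 < n)%N.
  rewrite lt0n; apply/eqP => n0; case: prP => _ _ P1 _; apply: P1.
  have [c] := bS 1 (in_OL1 L); rewrite mxE big1 ?subr0 // => i _.
  by have := ltn_ord i; rewrite {2}n0.
(* With all coefficients 1 the linearized polynomial is the trace polynomial. *)
have one_neq0 : const_mx 1 != 0 :> 'rV[K]_n.
  by apply/eqP => /rowP/(_ (Ordinal n_gt0)); rewrite !mxE => /eqP; rewrite oner_eq0.
have [j0 j0P] := linearized_nonroot pK xF one_neq0.
have [N NP] := modbasis_coord (u := b j0 0 *: b) bb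
  (fun i => eq_ind_r (@in_OL L) (in_OLM (Ob j0) (Ob i)) (mxE _ _ i 0)).
exists (b j0 0), (\tr N)%:~R; split=> //; first by exists n, b, N.
rewrite (intFp_eq0 p_pr) (dvdz_pcharf pK); apply: contra j0P => /eqP trN.
(* The Moore matrix of the basis, an analogue of [embed] with Frobenius powers as embeddings. A row
   c with c V = 0 would be a linearized polynomial vanishing on the whole basis. *)
pose V := \matrix_(i < n, j < n) x j ^+ (p ^ i).
have V0 : \det V != 0.
  apply/negP => /det0P[c c0 cV]; have [j /eqP[]] := linearized_nonroot pK xF c0.
  rewrite horner_linearized; move/rowP/(_ j): cV; rewrite !mxE; apply: eq_trans.
  by apply: eq_bigr => i _; rewrite mxE.
pose D := \row_i x j0 ^+ (p ^ i) : 'rV[K]_n.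
have DV : diag_mx D *m V = V *m (zmx N)^T.
  rewrite mul_diag_mx; apply/matrixP => i j; rewrite !mxE -exprMn.
  have -> : x j0 * x j = \sum_k (N j k)%:~R * x k.
    transitivity (f (\sum_k (row j N 0 k)%:~R * r k)); last first.
      by rewrite fsum; apply: eq_bigr => k _; rewrite mxE.
    apply/eqP; rewrite -subr_eq0 -rmorphM -rmorphB; apply/eqP/f0.
    rewrite rmorphB rmorphM /= !rE vsum map_row -row_mul [row _ _ _ _]mxE.
    by have := NP j; rewrite [(_ *: b) j 0]mxE.
  rewrite (Frobenius_iter_sum pK); apply: eq_bigr => k _.
  by rewrite !mxE mulrC.
have := trace_of_conjugate V0 DV; rewrite mxtrace_tr trace_map_mx /= trN => DS.
apply/eqP; rewrite horner_linearized; apply: etrans (esym DS).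
by apply: eq_bigr => i _; rewrite !mxE mul1r.
Qed.

(** * The trace along a factorization *)

Section Decomposition.
Variables (L : fieldExtType rat) (d p : nat).
Hypothesis p_pr : prime p.
Hypothesis lattice : forall I : L -> Prop, is_ideal I ->
  forall m, (0 < m)%N -> I m%:R -> exists b : 'cV[L]_d,
    (forall i, I (b i 0)) /\ forall x, I x -> exists c : 'rV[int]_d, x = (zmx c *m b) 0 0.
Implicit Types (I J K P : L -> Prop) (x y z : L).
Local Notation pO := (@principal_nat L p).

Lemma principal_cancel K x : is_ideal K -> ideal_mul pO K (p%:R * x) -> K x.
Proof. by move=> iK /(mul_principal _ _ iK)[k Kk /(mulfI (p_neq0 L p_pr))->]. Qed.

(* There is no ideal strictly between I Q and I, so I = a O + I Q for any a in I
   outside I Q, and multiplication by a identifies O / Q with I / (I Q). *)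
Lemma trmod_mul_prime I C Q x (t : 'F_p) : is_ideal I -> is_ideal C ->
  prime_ideal Q -> Q p%:R -> ideal_mul I C = pO ->
  trmod (@in_OL L) Q x t -> trmod I (ideal_mul I Q) x t.
Proof.
move=> iI iC prQ Qp IC; have iQ := is_ideal_prime prQ.
set J := ideal_mul I Q.
have iJ : is_ideal J by apply: is_ideal_mul.
have JI u : J u -> I u.
  by apply: ideal_mul_sub => // v w Iv Qw; apply: idealMr => //; apply: ideal_sub Qw.
have JC : ideal_mul J C = ideal_mul pO Q.
  by rewrite -IC /J -!ideal_mulA [ideal_mul Q C]ideal_mulC.
(* Otherwise I = I Q; multiplying by C gives p O_L = p Q, hence 1 in Q. *)
have [a Ia Ja] : exists2 a, I a & ~ J a.
  apply: contrapT => h; case: prQ => _ _ Q1 _; apply: Q1; apply: principal_cancel => //.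
  rewrite -JC mulr1; have := principal_self L p; rewrite -IC.
  by apply: ideal_mulS => // u Iu; apply: contrapT => Ju; apply: h; exists u.
have Oa := ideal_sub iI Ia.
apply: (trmod_iso iJ (a := a)).
- by move=> y Oy; apply: idealMr.
- pose K := adjoin J a; have iK : is_ideal K by apply: is_ideal_adjoin.
  have KI u : K u -> I u.
    by move=> [v [y [Jv Oy ->]]]; apply: idealD => //; [apply: JI|apply: idealM].
  (* M stands for K I^-1. It contains Q; were it inside Q, then a would lie in I Q. So 1 is in M and
     K = I. *)
  pose M := over_p p (ideal_mul K C).
  have iM : is_ideal M by apply: is_ideal_over_p; apply: is_ideal_mul.
  have QM q : Q q -> M q.
    move=> Qq; split; first exact: ideal_sub Qq.
    suff : ideal_mul J C (p%:R * q) by apply: ideal_mulS => // u; apply: adjoin_sub.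
    by rewrite JC; apply: ideal_mul_in => //; apply: principal_self.
  have [m Mm Qm] : exists2 m, M m & ~ Q m.
    apply: contrapT => h; apply: Ja; apply: principal_cancel => //.
    have : ideal_mul (ideal_mul K C) I (p%:R * a).
      rewrite -ideal_mulA [ideal_mul C I]ideal_mulC IC mulrC.
      by apply: ideal_mul_in; [apply: adjoin_self|apply: principal_self].
    rewrite /J [ideal_mul I Q]ideal_mulC ideal_mulA; apply: ideal_mulS => // u KCu.
    have [w [Ow uE]] : pO u by rewrite -IC; apply: ideal_mulS KCu.
    rewrite uE; apply: ideal_mul_in; first exact: principal_self.
    apply: contrapT => Qw; apply: h; exists w => //.
    by split=> //; rewrite -uE.
  have [w Ow Qw] := prime_maximal p_pr lattice prQ Qp (ideal_sub iM Mm) Qm.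
  have [_ KCp] : M 1.
    rewrite -(subrK (w * m) 1); apply: idealD => //; first exact: QM.
    exact: idealM.
  rewrite mulr1 in KCp => y Iy; have : K y.
    apply: principal_cancel => //.
    rewrite -IC ideal_mulC [ideal_mul I C]ideal_mulC ideal_mulA.
    exact: ideal_mul_in.
  by case=> u [z [Ju Oz ->]]; exists z => //; rewrite mulrC addrK.
- move=> z Oz Jaz; apply: contrapT => Qz; apply: Ja.
  have [w Ow Qw] := prime_maximal p_pr lattice prQ Qp Oz Qz.
  have -> : a = a * (1 - w * z) + w * (a * z) by ring.
  by apply: idealD => //; [apply: ideal_mul_in|apply: idealM].
- by move=> y Qy; apply: ideal_mul_in.
Qed.

Section Factorization.
Variables (s : nat) (P : 'I_s -> L -> Prop) (e : 'I_s -> nat).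
Hypothesis fact : is_factorization p P e.

Let prP i : prime_ideal (P i). Proof. by case: fact. Qed.
Let iP i : is_ideal (P i). Proof. exact: is_ideal_prime. Qed.

Let primes_of (r : seq 'I_s) : seq {classic (L -> Prop)} := map P r.

Let iprimes r : {in primes_of r, forall I : {classic (L -> Prop)}, is_ideal I}.
Proof. by move=> _ /mapP[i _ ->]; apply: iP. Qed.

(** Indices repeated with multiplicity: its prefixes give the chain of ideals descending from O_L to
    p O_L. *)
Let r0 := flatten [seq nseq (e i) i | i <- enum 'I_s].

Let prod_r0 : ideal_prod (primes_of r0) = pO.
Proof.
case: fact => _ _ _ /ideal_ext->; rewrite -(ideal_prod_pows _ _ iP) /primes_of /r0.
rewrite map_flatten -map_comp; congr (ideal_prod (flatten _)).
by apply: eq_map => i /=; rewrite map_nseq.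
Qed.

Lemma factorization_p_mem i : P i p%:R.
Proof.
have := principal_self L p; rewrite -prod_r0.
apply: (ideal_prod_sub (iprimes (r := r0))); apply/mapP; exists i => //.
apply/flattenP; exists (nseq (e i) i); first by apply: map_f; rewrite mem_enum.
by rewrite mem_nseq eqxx andbT; case: fact.
Qed.

(** The suffix r' supplies the cofactor that makes each partial product invertible and shows that it
    contains p. *)
Lemma trmod_prefix r r' x (t : 'I_s -> 'F_p) : in_OL x ->
  ideal_prod (primes_of (r ++ r')) = pO ->
  (forall i, trmod (@in_OL L) (P i) x (t i)) ->
  trmod (@in_OL L) (ideal_prod (primes_of r)) x (\sum_(i <- r) t i).
Proof.
move=> Ox + tP; elim/last_ind: r r' => [|r i IHr] r' rE.
  by rewrite big_nil; apply: trmod_trivial; apply: is_ideal_OL.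
rewrite cat_rcons in rE; have trI := IHr _ rE.
have {}rE : ideal_mul (ideal_prod (primes_of r))
    (ideal_mul (P i) (ideal_prod (primes_of r'))) = pO.
  by rewrite -rE /primes_of map_cat (ideal_prod_cat (L := L)) //; apply: iprimes.
set I := ideal_prod (primes_of r) in trI rE *.
have iI : is_ideal I by apply: is_ideal_prod; apply: iprimes.
have iIP : is_ideal (ideal_mul I (P i)) by apply: is_ideal_mul.
have -> : ideal_prod (primes_of (rcons r i)) = ideal_mul I (P i).
  rewrite /primes_of map_rcons -cats1 (ideal_prod_cat (L := L)) /=.
    by congr ideal_mul; rewrite ideal_mulC ideal_mul_OL.
  by move=> J; rewrite inE => /eqP->; apply: iP.
have i' : is_ideal (ideal_prod (primes_of r')) by apply: is_ideal_prod; apply: iprimes.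
rewrite -cats1 big_cat big_seq1; apply: (trmod_cat p_pr (J := I)) => //.
- exact: is_ideal_OL.
- by apply: ideal_mul_sub => // u v Iu Pv; apply: idealMr => //; apply: ideal_sub Pv.
- by move=> u; apply: ideal_sub.
- move=> y Oy; apply: idealMr => //; have := principal_self L p.
  rewrite -rE ideal_mulA; apply: ideal_mul_sub => // u v IPu rv.
  by apply: idealMr => //; apply: ideal_sub rv.
- apply: trmod_mul_prime rE (tP i) => //; first exact: is_ideal_mul.
  exact: factorization_p_mem.
Qed.

Lemma trmod_factorization x (t : 'I_s -> 'F_p) : in_OL x ->
  (forall i, trmod (@in_OL L) (P i) x (t i)) ->
  trmod (@in_OL L) pO x (\sum_i (e i)%:R * t i).
Proof.
move=> Ox tP; have := trmod_prefix (r := r0) (r' := [::]) Ox _ tP.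
rewrite cats0 prod_r0 => /(_ erefl).
suff -> : \sum_(i <- r0) t i = \sum_i (e i)%:R * t i by [].
rewrite big_flatten big_map big_enum; apply: eq_bigr => i _.
by rewrite big_nseq iter_addr_0 mulr_natl.
Qed.

(** A product of elements u_j of P_j outside P_i is outside P_i, so a multiple of it is 1 modulo
    P_i. At j = i the choice of u is arbitrary. *)
Lemma factorization_idempotent i : exists z,
  [/\ in_OL z, P i (1 - z) & forall j, j != i -> P j z].
Proof.
have sep j : exists u, j != i -> P j u /\ ~ P i u.
  have [->|ji] := eqVneq j i; first by exists 0.
  apply: contrapT => h; case: fact => _ /(_ _ _ ji) Pji _ _; apply: Pji.
  apply: (prime_inclusion_eq p_pr lattice) => //; first exact: factorization_p_mem.
  by move=> u Pu; apply: contrapT => Pu'; apply: h; exists u.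
have [u uP] := choice sep; pose v := \prod_(j | j != i) u j.
have [Ov Pv] : in_OL v /\ ~ P i v.
  have [_ _ P1 PM] := prP i.
  apply: (big_ind (fun v => in_OL v /\ ~ P i v)).
  - by split; [apply: in_OL1|].
  - by move=> y z [Oy Py] [Oz Pz]; split; [apply: in_OLM|case/PM].
  - by move=> j /uP[Pu Piu]; split=> //; apply: ideal_sub Pu.
have [w Ow Pw] := prime_maximal p_pr lattice (prP i) (factorization_p_mem i) Ov Pv.
exists (w * v); split=> // [|j ji]; first exact: in_OLM.
apply: idealM => //; rewrite /v (bigD1 j) //= ; apply: idealMr => //.
  apply: (big_ind (@in_OL L)) => [|y z|k /andP[/uP[Pu _] _]].
  - exact: in_OL1.
  - exact: in_OLM.
  - exact: ideal_sub Pu.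
by case: (uP j ji).
Qed.

Lemma prime_modbasis i : exists n (b : 'cV[L]_n), modbasis p (@in_OL L) (P i) b.
Proof.
have [b [Ob bS]] := lattice (is_ideal_OL L) (ltn0Sn 0) (in_OL1 L).
apply: (modbasis_exists p_pr) bS => //; first exact: is_ideal_OL.
by move=> y Oy; apply: idealMr => //; apply: factorization_p_mem.
Qed.

(** z y acts like y on O_L / P_i and like 0 on the other residue fields. *)
Lemma trmod_select i : exists x (t : 'I_s -> 'F_p),
  [/\ in_OL x, t i != 0, forall j, j != i -> t j = 0 &
  forall j, trmod (@in_OL L) (P j) x (t j)].
Proof.
have [z [Oz Pz PJz]] := factorization_idempotent i.
have [n [b bb]] := prime_modbasis i; have Pp := factorization_p_mem i.
have [y [t [Oy yt t0]]] := residue_trace_neq0 p_pr (prP i) Pp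
  (fun x => prime_maximal p_pr lattice (prP i) Pp (x := x)) bb.
have Ozy := in_OLM Oz Oy.
exists (z * y), (fun j => if j == i then t else 0); split; rewrite ?eqxx //.
  by move=> j /negPf->.
move=> j; have [->|ji] := eqVneq j i.
  have [m [c [N [bc yc tN]]]] := yt; exists m, c, N; split=> // k.
  have -> : (z * y *: c) k 0 - (zmx N *m c) k 0 =
    ((y *: c) k 0 - (zmx N *m c) k 0) - (1 - z) * ((y *: c) k 0) by rewrite !mxE; ring.
  apply: idealB => //; apply: idealMr => //; rewrite mxE; apply: in_OLM => //.
  by case: bc.
have [m [c bc]] := prime_modbasis j; exists m, c, 0; split=> //; last by rewrite mxtrace0.
move=> k; rewrite map_mx0 mul0mx !mxE subr0 -mulrA; apply: idealMr => //.
  by apply: in_OLM => //; case: bc.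
exact: PJz.
Qed.

End Factorization.
End Decomposition.

(** * Comparison of the trace of L with the exponents of p *)

Lemma lattice_basis_coord (L : fieldExtType rat)
    (sigma : 'I_(\dim {:L}) -> {rmorphism L -> algC}) :
  (forall x, in_OL x -> exists k : int, Tr sigma x = k%:~R) ->
  forall I : L -> Prop, is_ideal I -> forall m, (0 < m)%N -> I m%:R ->
  exists b : 'cV[L]_(\dim {:L}), (forall i, I (b i 0)) /\
    forall x, I x -> exists c : 'rV[int]_(\dim {:L}), x = (zmx c *m b) 0 0.
Proof.
by move=> Trz I iI m m0 Im; have [b [Ib _ bS]] := lattice_basis Trz iI m0 Im; exists b.
Qed.

(** A Z-basis of O_L is also a basis modulo p, so one integer matrix computes both traces;
    [trmod_unique] identifies its trace modulo p with t. *)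
Lemma Tr_trmod (L : fieldExtType rat) (sigma : 'I_(\dim {:L}) -> {rmorphism L -> algC})
    (p : nat) x (t : 'F_p) :
  (forall x, in_OL x -> exists k : int, Tr sigma x = k%:~R) -> prime p -> in_OL x ->
  trmod (@in_OL L) (@principal_nat L p) x t ->
  exists2 k : int, Tr sigma x = k%:~R & t = k%:~R.
Proof.
move=> Trz p_pr Ox xt.
have [b [Ob b0 bS]] := lattice_basis Trz (is_ideal_OL L) (ltn0Sn 0) (in_OL1 L).
have iO := is_ideal_principal L p.
have bb : modbasis p (@in_OL L) (@principal_nat L p) b.
  split=> // [y /bS[c ->]|c [y [/bS[c' ->] cE]]].
    by exists c; rewrite subrr; apply: ideal0.
  have /eqP : c - p%:Z *: c' = 0.
    apply: (coord_unique b0); apply/matrixP => i j; rewrite !ord1.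
    rewrite map_mxB map_mxZ mulmxBl -scalemxAl.
    transitivity ((zmx c *m b) 0 0 - p%:R * (zmx c' *m b) 0 0); first by rewrite !mxE.
    by rewrite cE subrr mxE.
  rewrite subr_eq0 => /eqP->; apply/rowP => i; rewrite !mxE intrM.
  by rewrite -pmulrn pchar_Fp_0 // mul0r.
have /choice[c cE] i := bS _ (in_OLM Ox (Ob i)).
pose N := \matrix_i c i.
have xb : x *: b = zmx N *m b.
  apply/matrixP => i j; rewrite ord1 mxE cE !mxE; apply: eq_bigr => k _.
  by rewrite !mxE.
exists (\tr N); first exact: Tr_mxtrace xb.
apply: (trmod_unique iO _ Ox xt); first by move=> y; apply: ideal_sub.
by exists _, b, N; split=> // i; rewrite xb subrr; apply: ideal0.
Qed.

Lemma divides_trace_iff (L : fieldExtType rat)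
    (sigma : 'I_(\dim {:L}) -> {rmorphism L -> algC}) (p : nat) :
  (forall x, in_OL x -> exists k : int, Tr sigma x = k%:~R) -> prime p ->
  (forall x, in_OL x -> exists k : int, Tr sigma x = p%:R * k%:~R) <->
  divides_all_exponents L p.
Proof.
move=> Trz p_pr; have lat := lattice_basis_coord Trz.
split=> [pTr s P e fact i|pe x Ox].
  have [x [t [Ox ti tj xt]]] := trmod_select p_pr lat fact i.
  have [k kE tE] := Tr_trmod Trz p_pr Ox (trmod_factorization p_pr lat fact Ox xt).
  have [k' k'E] := pTr x Ox; move: tE.
  have -> : k = p%:Z * k'.
    by apply: (intr_inj (R := algC)); rewrite -kE k'E intrM.
  rewrite intrM -pmulrn pchar_Fp_0 // mul0r (bigD1 i) //= big1 ?addr0 => [|j ji].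
    move=> /eqP; rewrite mulf_eq0 (negPf ti) orbF.
    by rewrite (dvdn_pcharf (pchar_Fp p_pr)).
  by rewrite tj ?mulr0.
have [s [P [e fact]]] := factorization_exists p_pr lat.
have /choice[t tP] i : exists t : 'F_p, trmod (@in_OL L) (P i) x t.
  have [b [Ob bS]] := lat _ (is_ideal_OL L) 1%N isT (in_OL1 L).
  have iP : is_ideal (P i) by case: fact => /(_ i)/is_ideal_prime.
  apply: (trmod_exists p_pr (is_ideal_OL L) iP _ Ob bS Ox) => y Oy.
  by apply: idealMr => //; apply: factorization_p_mem fact i.
have [k kE tE] := Tr_trmod Trz p_pr Ox (trmod_factorization p_pr lat fact Ox tP).
have : k%:~R = 0 :> 'F_p.
  rewrite -tE big1 // => i _; have /dvdnP[q ->] := pe _ _ _ fact i.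
  by rewrite natrM pchar_Fp_0 // mulr0 mul0r.
move=> /eqP; rewrite (intFp_eq0 p_pr) => /dvdzP[q kq]; exists q.
by rewrite kE kq intrM mulrC.
Qed.

Theorem theorem1 (L : fieldExtType rat)
    (sigma : 'I_(\dim {:L}) -> {rmorphism L -> algC})
    (sigma_inj : forall i j, i != j -> exists x, sigma i x != sigma j x)
    (sigma_all : forall f : {rmorphism L -> algC}, exists i, forall x, f x = sigma i x)
    (tL : nat) (tL_pos : (0 < tL)%N)
    (tL_def : forall z : algC,
        (exists x, in_OL x /\ \sum_(i < \dim {:L}) sigma i x = z)
        <-> exists k : int, z = tL%:R * k%:~R) :
  ((2 <= tL)%N <->
     exists p, [/\ prime p, (p %| \dim {:L})%N & divides_all_exponents L p])
  /\
  ((exists p, [/\ prime p, (p %| \dim {:L})%N & divides_all_exponents L p]) <->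
     exists p, prime p /\ divides_all_exponents L p).
Proof.
have TrL x : in_OL x -> exists k : int, Tr sigma x = tL%:R * k%:~R.
  by move=> Ox; apply/tL_def; exists x.
have Trz x : in_OL x -> exists k : int, Tr sigma x = k%:~R.
  by move/TrL=> [k ->]; exists (tL%:Z * k); rewrite intrM.
have key p : prime p -> (p %| tL)%N <-> divides_all_exponents L p.
  move=> p_pr; rewrite -(divides_trace_iff Trz p_pr); split=> [/dvdnP[q tLq] x Ox|pTr].
    have [k ->] := TrL x Ox; exists (q%:Z * k).
    by rewrite tLq natrM intrM mulrAC mulrC mulrA.
  (* [tL] is itself the trace of an integer, so p divides it when p divides all traces. *)
  have [x [Ox xE]] : exists x, in_OL x /\ Tr sigma x = tL%:R.
    by apply/tL_def; exists 1; rewrite mulr1.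
  have [k kE] := pTr x Ox; apply/dvdnP; exists `|k|%N.
  have /(congr1 absz) : tL%:Z = p%:Z * k.
    by apply: (intr_inj (R := algC)); rewrite intrM -kE xE.
  by rewrite abszM !absz_nat mulnC.
have tL_dim : (tL %| \dim {:L})%N.
  have [k kE] := TrL 1 (in_OL1 L); apply/dvdnP; exists `|k|%N.
  have /(congr1 absz) : (\dim {:L})%:Z = tL%:Z * k.
    by apply: (intr_inj (R := algC)); rewrite intrM -kE Tr1.
  by rewrite abszM !absz_nat mulnC.
have all_dim p : prime p -> divides_all_exponents L p -> (p %| \dim {:L})%N.
  by move=> p_pr /key-/(_ p_pr) ptL; apply: dvdn_trans tL_dim.
split; split.
- move=> tL2; have p_pr := pdiv_prime tL2; exists (pdiv tL).
  have ptL := (key _ p_pr).1 (pdiv_dvd tL).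
  by split=> //; apply: all_dim.
- move=> [p [p_pr _ /key-/(_ p_pr) ptL]].
  exact: leq_trans (prime_gt1 p_pr) (dvdn_leq tL_pos ptL).
- by move=> [p [p_pr _ pe]]; exists p.
- by move=> [p [p_pr pe]]; exists p; split=> //; apply: all_dim.
Qed.
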